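(* Let $\mathcal{P}=He_1\oplus He_2$ be the free left $H$-module of rank two with basis $e_1,e_2$, equipped with an $H$-pseudoalgebra structure such that $e_{1}\ast e_{1}=t_{1}\otimes1 \otimes_{H}e_{1}$ and $e_{2}\ast e_{2}=t_{2}\otimes1 \otimes_{H}e_{2}$ for some nonzero $t_{1}, t_{2}\in\mathbf{k}$ (and $e_1\ast e_2$, $e_2\ast e_1$ are arbitrary elements of $(H\otimes H)\otimes_H\mathcal{P}$). Then $\mathcal{P}$ is associative if and only if one of the following holds: (1) $e_{1}\ast e_{2}=e_{2}\ast e_{1}=0$; (2) $e_{1}\ast e_{2}=t_{2}\otimes1 \otimes_{H}e_{1}$, $e_{2}\ast e_{1}=t_{2}\otimes1 \otimes_{H}e_{1}$; (3) $e_{1}\ast e_{2}=t_{1}\otimes1 \otimes_{H}e_{2}$, $e_{2}\ast e_{1}=t_{2}\otimes1 \otimes_{H}e_{1}$; (4) $e_{1}\ast e_{2}=t_{2}\otimes1 \otimes_{H}e_{1}$, $e_{2}\ast e_{1}=t_{1}\otimes1 \otimes_{H}e_{2}$; (5) $e_{1}\ast e_{2}=t_{1}\otimes1 \otimes_{H}e_{2}$, $e_{2}\ast e_{1}=t_{1}\otimes1 \otimes_{H}e_{2}$.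
   Context: $\mathbf{k}$ is an algebraically closed field of characteristic $0$, $\delta$ is a finite-dimensional Lie algebra over $\mathbf{k}$, and $H=U(\delta)$ is its universal enveloping algebra with the standard cocommutative Hopf structure ($\Delta(x)=x\otimes1+1\otimes x$ for $x\in\delta$). We regard $\mathbf{k},\delta\subset H$. $H^{\otimes n}$ is a right $H$-module via the iterated coproduct, e.g. $(f\otimes g)\cdot h=(f\otimes g)\Delta(h)$. An $H$-pseudoalgebra is a left $H$-module $A$ with a map $\ast:A\otimes A\to(H\otimes H)\otimes_H A$ that is $H$-bilinear: $hx\ast gy=(h\otimes g\otimes_H1)(x\ast y)$ for $x,y\in A$, $h,g\in H$. For $\beta\in H\otimes H$ and $x\ast y=\sum_i\alpha_i\otimes_Hc_i$ one sets, in $H^{\otimes3}\otimes_HA$, $(\beta\otimes_Hx)\ast y=\sum_i(\beta\otimes1)(\Delta\otimes\mathrm{id})(\alpha_i)\otimes_Hc_i$ and $x\ast(\beta\otimes_Hy)=\sum_i(1\otimes\beta)(\mathrm{id}\otimes\Delta)(\alpha_i)\otimes_Hc_i$. $A$ is associative if $(x\ast y)\ast z=x\ast(y\ast z)$ for all $x,y,z\in A$. Conventions: $f\otimes g\otimes_He$ means $(f\otimes g)\otimes_He$. By $H$-bilinearity a pseudoproduct on a free module is determined by its values on basis elements. *)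

(* Defs.v *)
From HB Require Import structures.
From mathcomp Require Import all_boot all_order all_algebra.
From mathcomp Require Import boolp.

Set Implicit Arguments.
Unset Strict Implicit.
Unset Printing Implicit Defensive.

Import GRing.Theory.
Local Open Scope ring_scope.
Local Open Scope quotient_scope.

Reserved Notation "M ⊗ N" (at level 40, left associativity).
Reserved Notation "a ⊗_H c" (at level 40, left associativity).

(* [btensor ra la] is [M ⊗_S N] for a right action [ra] of [S] on [M] and a
   left action [la] of [S] on [N]: formal sums of pairs, modulo the congruence
   generated by biadditivity and [ra m s ⊗ n = m ⊗ la s n]. *)

Section BalancedTensor.
Context {S : Type} {M N : zmodType} (ra : M -> S -> M) (la : S -> N -> N).

Inductive bt_eq : seq (M * N) -> seq (M * N) -> Prop :=
| bt_refl s : bt_eq s s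
| bt_sym s t : bt_eq s t -> bt_eq t s
| bt_trans t s u : bt_eq s t -> bt_eq t u -> bt_eq s u
| bt_cat s s' t t' : bt_eq s s' -> bt_eq t t' -> bt_eq (s ++ t) (s' ++ t')
| bt_catC s t : bt_eq (s ++ t) (t ++ s)
| bt_0l n : bt_eq [:: (0, n)] [::]
| bt_Dl m m' n : bt_eq [:: (m + m', n)] [:: (m, n); (m', n)]
| bt_Dr m n n' : bt_eq [:: (m, n + n')] [:: (m, n); (m, n')]
| bt_bal m s n : bt_eq [:: (ra m s, n)] [:: (m, la s n)].

Definition bt_rel s t := `[< bt_eq s t >].

Lemma bt_rel_equiv : equiv_class_of bt_rel.
Proof.
split=> [s|s t|t s u].
- by apply/asboolP; apply: bt_refl.
- by apply/asboolP/asboolP; apply: bt_sym.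
- by move=> /asboolP h /asboolP h'; apply/asboolP; apply: bt_trans h h'.
Qed.

Canonical bt_equivrel := EquivRelPack bt_rel_equiv.

Definition btensor := {eq_quot bt_equivrel}.

HB.instance Definition _ : EqQuotient _ bt_equivrel btensor :=
  EqQuotient.on btensor.
HB.instance Definition _ := Choice.on btensor.

Definition bt_pure (m : M) (n : N) : btensor := \pi_btensor [:: (m, n)].

Lemma bt_piP (s t : seq (M * N)) : bt_eq s t <-> \pi_btensor s = \pi_btensor t.
Proof.
split; first by move=> h; apply/eqmodP/asboolP.
by move=> /eqmodP /asboolP.
Qed.

Lemma bt_piW (P : btensor -> Prop) :
  (forall s, P (\pi_btensor s)) -> forall x, P x.
Proof. by move=> h x; rewrite -[x]reprK. Qed.

Definition bt_zero : btensor := \pi_btensor [::].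
Definition bt_add (x y : btensor) : btensor := \pi_btensor (repr x ++ repr y).
Definition bt_oppseq (s : seq (M * N)) := [seq (- mn.1, mn.2) | mn <- s].
Definition bt_opp (x : btensor) : btensor := \pi_btensor (bt_oppseq (repr x)).

Lemma bt_repr s : bt_eq (repr (\pi_btensor s)) s.
Proof. by apply/bt_piP; rewrite reprK. Qed.

Lemma bt_add_pi s t : bt_add (\pi_btensor s) (\pi_btensor t) = \pi_btensor (s ++ t).
Proof. by apply/bt_piP; apply: bt_cat; apply: bt_repr. Qed.

Fact bt_addA : associative bt_add.
Proof.
by elim/bt_piW=> s; elim/bt_piW=> t; elim/bt_piW=> u; rewrite !bt_add_pi catA.
Qed.

Fact bt_addC : commutative bt_add.
Proof.
elim/bt_piW=> s; elim/bt_piW=> t; rewrite !bt_add_pi; apply/bt_piP.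
exact: bt_catC.
Qed.

Fact bt_add0 : left_id bt_zero bt_add.
Proof. by elim/bt_piW=> s; rewrite bt_add_pi. Qed.

Fact bt_addN : left_inverse bt_zero bt_opp bt_add.
Proof.
elim/bt_piW=> s; rewrite /bt_opp -{2}[\pi_btensor s]reprK bt_add_pi; apply/bt_piP.
elim: (repr _) => [|[m n] r IHr]; first exact: bt_refl.
rewrite /= -cat1s -[(m, n) :: r]cat1s -[_ :: _]cat1s catA.
apply: (bt_trans (t := ([:: (- m, n)] ++ [:: (m, n)]) ++ (bt_oppseq r ++ r))).
  rewrite -!catA; apply: bt_cat (bt_refl _) _; rewrite !catA.
  by apply: bt_cat (bt_refl _); apply: bt_catC.
rewrite -[[::]]/([::] ++ [::]); apply: bt_cat => //.
apply: (bt_trans (t := [:: (- m + m, n)])); first exact/bt_sym/bt_Dl.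
by rewrite addNr; apply: bt_0l.
Qed.

HB.instance Definition _ :=
  GRing.isZmodule.Build btensor bt_addA bt_addC bt_add0 bt_addN.

Lemma bt_piD s t : \pi_btensor (s ++ t) = \pi_btensor s + \pi_btensor t.
Proof. by rewrite -bt_add_pi. Qed.

Lemma bt_pureDl m m' n : bt_pure (m + m') n = bt_pure m n + bt_pure m' n.
Proof. by rewrite -bt_piD; apply/bt_piP/bt_Dl. Qed.

Lemma bt_pureDr m n n' : bt_pure m (n + n') = bt_pure m n + bt_pure m n'.
Proof. by rewrite -bt_piD; apply/bt_piP/bt_Dr. Qed.

Lemma bt_pure_bal m s n : bt_pure (ra m s) n = bt_pure m (la s n).
Proof. exact/bt_piP/bt_bal. Qed.

Lemma bt_ind (P : btensor -> Prop) :
  (forall m n, P (bt_pure m n)) -> (forall x y, P x -> P y -> P (x + y)) ->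
  forall x, P x.
Proof.
move=> Pp PD; apply: bt_piW; elim=> [|[m n] s IHs].
  suff -> : \pi_btensor [::] = bt_pure 0 0 by [].
  exact/bt_piP/bt_sym/bt_0l.
by rewrite -cat1s bt_piD; exact: PD (Pp m n) IHs.
Qed.

End BalancedTensor.

Arguments btensor {S M N} ra la.
Arguments bt_piW {S M N ra la} P.
Arguments bt_ind {S M N ra la} P.
Arguments bt_pure {S M N} ra la m n.

Record balanced (S : Type) (M N : zmodType) (ra : M -> S -> M)
    (la : S -> N -> N) (Z : zmodType) (f : M -> N -> Z) : Prop := Balanced {
  balDl : forall m m' n, f (m + m') n = f m n + f m' n;
  balDr : forall m n n', f m (n + n') = f m n + f m n';
  balM : forall m s n, f (ra m s) n = f m (la s n) }.

(* The additive map induced by a balanced [f]; see [bt_liftE]. *)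
HB.lock Definition bt_lift (S : Type) (M N : zmodType) (ra : M -> S -> M)
    (la : S -> N -> N) (Z : zmodType) (f : M -> N -> Z) (x : btensor ra la) : Z :=
  \sum_(mn <- repr x) f mn.1 mn.2.

Arguments bt_lift {S M N ra la Z} f x.

Canonical bt_lift_unlockable := Unlockable bt_lift.unlock.

Section Lift.
Context {S : Type} {M N : zmodType} {ra : M -> S -> M} {la : S -> N -> N}.
Context {Z : zmodType} (f : M -> N -> Z) (bf : balanced ra la f).
Local Notation T := (btensor ra la).

Lemma bt_lift_pi s : bt_lift f (\pi_T s) = \sum_(mn <- s) f mn.1 mn.2.
Proof.
rewrite unlock; move: (repr _) (bt_repr ra la s) => r; elim=> {r s} //=.
- by move=> s t u _ -> _ ->.
- by move=> s1 s2 t1 t2 _ e1 _ e2; rewrite !big_cat /= e1 e2.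
- by move=> s1 s2; rewrite !big_cat /= addrC.
- move=> n; rewrite big_seq1 big_nil /=.
  by apply: (addrI (f 0 n)); rewrite -(balDl bf) !addr0.
- by move=> m m' n; rewrite !big_cons !big_nil !addr0 /= (balDl bf).
- by move=> m n n'; rewrite !big_cons !big_nil !addr0 /= (balDr bf).
- by move=> m s' n; rewrite !big_seq1 /= (balM bf).
Qed.

Lemma bt_liftE m n : bt_lift f (bt_pure ra la m n) = f m n.
Proof. by rewrite bt_lift_pi big_seq1. Qed.

Lemma bt_liftD : {morph (bt_lift f : T -> Z) : x y / x + y}.
Proof.
have ind := @bt_piW S M N ra la.
by elim/ind=> s; elim/ind=> t; rewrite -bt_piD !bt_lift_pi big_cat.
Qed.

End Lift.


(* Augmentations (counits) serve to see that [1 ⊗ 1 != 0], as required of an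
   [algType]. *)
HB.mixin Record Algebra_isAugmented (K : fieldType) A of GRing.Algebra K A := {
  aug : A -> K;
  aug_scalar : scalar aug;
  aug1 : aug 1 = 1;
  augM : {morph aug : x y / x * y} }.

#[short(type="augAlgType")]
HB.structure Definition AugAlgebra (K : fieldType) :=
  {A of Algebra_isAugmented K A & GRing.Algebra K A}.

Section KTensor.
Context {K : fieldType}.

Definition ract (V : lmodType K) (v : V) (c : K) : V := c *: v.
Definition lact (V : lmodType K) (c : K) (v : V) : V := c *: v.

Definition ktens (V W : augAlgType K) := btensor (@ract V) (@lact W).

HB.instance Definition _ V W := GRing.Zmodule.on (ktens V W).

Definition tpure (V W : augAlgType K) (v : V) (w : W) : ktens V W :=
  bt_pure _ _ v w.

End KTensor.

Notation "M ⊗ N" := (ktens M N) : type_scope.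
Notation "v ⊗ w" := (tpure v w) : ring_scope.

Section KTensorLmod.
Context {K : fieldType}.
Implicit Types V W : augAlgType K.

Lemma tpureDl V W (v v' : V) (w : W) : (v + v') ⊗ w = v ⊗ w + v' ⊗ w.
Proof. exact: bt_pureDl. Qed.

Lemma tpureDr V W (v : V) (w w' : W) : v ⊗ (w + w') = v ⊗ w + v ⊗ w'.
Proof. exact: bt_pureDr. Qed.

Lemma tpureC V W c (v : V) (w : W) : (c *: v) ⊗ w = v ⊗ (c *: w).
Proof. exact: (bt_pure_bal (@ract K V) (@lact K W)). Qed.

Lemma tens_ind V W (P : (V ⊗ W)%type -> Prop) :
  (forall v w, P (v ⊗ w)) -> (forall x y, P x -> P y -> P (x + y)) ->
  forall x, P x.
Proof. exact: bt_ind. Qed.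

Definition tlift V W (Z : zmodType) (f : V -> W -> Z) : (V ⊗ W)%type -> Z :=
  bt_lift f.

Record kbalanced V W (Z : zmodType) (f : V -> W -> Z) : Prop := KBalanced {
  kbalDl : forall v v' w, f (v + v') w = f v w + f v' w;
  kbalDr : forall v w w', f v (w + w') = f v w + f v w';
  kbalM : forall c v w, f (c *: v) w = f v (c *: w) }.

Lemma kbalancedP V W (Z : zmodType) (f : V -> W -> Z) :
  kbalanced f -> balanced (@ract K V) (@lact K W) f.
Proof. by case=> h1 h2 h3; split=> // m s n; apply: h3. Qed.

Lemma tliftE V W (Z : zmodType) (f : V -> W -> Z) v w :
  kbalanced f -> tlift f (v ⊗ w) = f v w.
Proof. by move=> /kbalancedP bf; apply: bt_liftE. Qed.

Lemma tliftD V W (Z : zmodType) (f : V -> W -> Z) :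
  kbalanced f -> {morph tlift f : x y / x + y}.
Proof. by move=> /kbalancedP bf; apply: bt_liftD. Qed.

Section Scale.
Context (V W : augAlgType K).

Definition tscale (c : K) : (V ⊗ W)%type -> (V ⊗ W)%type :=
  tlift (fun v w => (c *: v) ⊗ w).

Lemma tscale_bal c : kbalanced (fun (v : V) (w : W) => (c *: v) ⊗ w).
Proof.
split=> [v v' w|v w w'|a v w].
- by rewrite scalerDr tpureDl.
- exact: tpureDr.
- by rewrite scalerA mulrC -scalerA tpureC.
Qed.

Lemma tscaleE c v w : tscale c (v ⊗ w) = (c *: v) ⊗ w.
Proof. exact: (tliftE _ _ (tscale_bal c)). Qed.

Fact tscaleDr : right_distributive tscale +%R.
Proof. by move=> c; apply: (tliftD (tscale_bal c)). Qed.

Fact tscaleA a b v : tscale a (tscale b v) = tscale (a * b) v.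
Proof.
elim/tens_ind: v => [v w|x y IHx IHy]; last by rewrite !tscaleDr IHx IHy.
by rewrite !tscaleE scalerA.
Qed.

Fact tscale1 : left_id 1 tscale.
Proof.
elim/tens_ind => [v w|x y IHx IHy]; last by rewrite !tscaleDr IHx IHy.
by rewrite tscaleE scale1r.
Qed.

Fact tscaleDl v : {morph tscale^~ v : a b / a + b}.
Proof.
move=> a b; elim/tens_ind: v => [v w|x y IHx IHy] /=.
  by rewrite !tscaleE scalerDl tpureDl.
by rewrite !tscaleDr IHx IHy addrACA.
Qed.

HB.instance Definition _ := GRing.Zmodule_isLmodule.Build K (ktens V W)
  tscaleA tscale1 tscaleDr tscaleDl.

Lemma tpureZl c (v : V) (w : W) : (c *: v) ⊗ w = c *: (v ⊗ w).
Proof. by rewrite -tscaleE. Qed.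

Lemma tpureZr c (v : V) (w : W) : v ⊗ (c *: w) = c *: (v ⊗ w).
Proof. by rewrite -tpureC tpureZl. Qed.

End Scale.

Definition bilin V W (X : lmodType K) (f : V -> W -> X) : Prop :=
  (forall w, linear (f^~ w)) /\ (forall v, linear (f v)).

Lemma bilin_kbal V W (X : lmodType K) (f : V -> W -> X) : bilin f -> kbalanced f.
Proof.
move=> [fl fr]; split=> [v v' w|v w w'|c v w].
- by rewrite -{1}[v]scale1r fl scale1r.
- by rewrite -{1}[w]scale1r fr scale1r.
- have fl0 : f 0 w = 0 by have := fl w (-1) v v; rewrite /= !scaleN1r !addNr.
  have fr0 : f v 0 = 0 by have := fr v (-1) w w; rewrite /= !scaleN1r !addNr.
  by rewrite -[c *: v]addr0 fl fl0 -[c *: w]addr0 fr fr0.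
Qed.

Lemma tlift_linear V W (X : lmodType K) (f : V -> W -> X) : bilin f -> linear (tlift f).
Proof.
move=> bf c x y; have kf := bilin_kbal bf; rewrite (tliftD kf); congr (_ + _).
elim/tens_ind: x => [v w|x x' IH IH'].
  rewrite -tpureZl !(tliftE _ _ kf) -[c *: v]addr0 bf.1.
  suff -> : f 0 w = 0 by rewrite addr0.
  by have := bf.1 w (-1) v v; rewrite /= !scaleN1r !addNr.
by rewrite scalerDr !(tliftD kf) IH IH' scalerDr.
Qed.

End KTensorLmod.

Section KTensorRing.
Context {K : fieldType} (A B : augAlgType K).
Local Notation T := (ktens A B).

Definition tmul (x y : T) : T :=
  tlift (fun a b => tlift (fun c d => (a * c) ⊗ (b * d)) y) x.

Lemma tmul_bilin a b : bilin (fun (c : A) (d : B) => (a * c) ⊗ (b * d)).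
Proof.
split=> [w c v v'|v c w w'].
  by rewrite mulrDr tpureDl -scalerAr tpureZl.
by rewrite mulrDr tpureDr -scalerAr tpureZr.
Qed.

Lemma tmul_bal y : kbalanced
  (fun a b => tlift (fun c d => (a * c) ⊗ (b * d)) y : T).
Proof.
split=> [v v' w|v w w'|c v w]; have h a b := bilin_kbal (tmul_bilin a b);
  elim/(@tens_ind K A B): y => [a b|x y IHx IHy].
- by rewrite !(tliftE _ _ (h _ _)) mulrDl tpureDl.
- by rewrite !(tliftD (h _ _)) IHx IHy addrACA.
- by rewrite !(tliftE _ _ (h _ _)) mulrDl tpureDr.
- by rewrite !(tliftD (h _ _)) IHx IHy addrACA.
- by rewrite !(tliftE _ _ (h _ _)) -!scalerAl tpureC.
- by rewrite !(tliftD (h _ _)) IHx IHy.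
Qed.

Lemma tmulE a b c d : tmul (a ⊗ b) (c ⊗ d) = (a * c) ⊗ (b * d).
Proof.
rewrite /tmul (tliftE _ _ (tmul_bal _)).
exact: (tliftE _ _ (bilin_kbal (tmul_bilin _ _))).
Qed.

Fact tmulDl : left_distributive tmul +%R.
Proof. by move=> x y z; apply: (tliftD (tmul_bal z)). Qed.

Fact tmulDr : right_distributive tmul +%R.
Proof.
move=> x y z; elim/(@tens_ind K A B): x => [a b|x x' IH IH'].
  rewrite /tmul !(tliftE _ _ (tmul_bal _)).
  exact: (tliftD (bilin_kbal (tmul_bilin _ _))).
by rewrite !tmulDl IH IH' addrACA.
Qed.

Fact tmulA : associative tmul.
Proof.
move=> x y z; elim/(@tens_ind K A B): x => [a b|x x' IH IH']; last first.
  by rewrite !tmulDl IH IH'.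
elim/(@tens_ind K A B): y => [c d|y y' IH IH']; last first.
  by rewrite !(tmulDl, tmulDr) IH IH'.
elim/(@tens_ind K A B): z => [e f|z z' IH IH']; last by rewrite !tmulDr IH IH'.
by rewrite !tmulE !mulrA.
Qed.

Fact tmul1 : left_id (1 ⊗ 1) tmul.
Proof.
elim/(@tens_ind K A B)=> [a b|x y IHx IHy]; last by rewrite tmulDr IHx IHy.
by rewrite tmulE !mul1r.
Qed.

Fact tmulr1 : right_id (1 ⊗ 1) tmul.
Proof.
elim/(@tens_ind K A B)=> [a b|x y IHx IHy]; last by rewrite tmulDl IHx IHy.
by rewrite tmulE !mulr1.
Qed.

HB.instance Definition _ := GRing.Zmodule_isPzRing.Build (ktens A B)
  tmulA tmul1 tmulr1 tmulDl tmulDr.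

Lemma tpureM (a c : A) (b d : B) : (a ⊗ b) * (c ⊗ d) = (a * c) ⊗ (b * d).
Proof. exact: tmulE. Qed.

Lemma tpure1 : (1 : A) ⊗ (1 : B) = 1.
Proof. by []. Qed.

Fact tscalerAl c (x y : ktens A B) : c *: (x * y) = (c *: x) * y.
Proof.
elim/(@tens_ind K A B): x => [a b|x x' IH IH']; last first.
  by rewrite mulrDl !scalerDr mulrDl IH IH'.
elim/(@tens_ind K A B): y => [a' b'|y y' IH IH']; last by rewrite !mulrDr scalerDr IH IH'.
by rewrite tpureM -!tpureZl tpureM scalerAl.
Qed.

Fact tscalerAr c (x y : ktens A B) : c *: (x * y) = x * (c *: y).
Proof.
elim/(@tens_ind K A B): x => [a b|x x' IH IH']; last first.
  by rewrite !mulrDl !scalerDr IH IH'.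
elim/(@tens_ind K A B): y => [a' b'|y y' IH IH'].
  by rewrite tpureM -!tpureZl tpureM scalerAr.
by rewrite mulrDr !scalerDr mulrDr IH IH'.
Qed.

End KTensorRing.

Section KTensorAug.
Context {K : fieldType} (A B : augAlgType K).

Definition taug : ktens A B -> K := tlift (fun a b => aug a * aug b).

Lemma taug_bilin : bilin (fun (a : A) (b : B) => aug a * aug b : K^o).
Proof.
split=> [w c v v'|v c w w']; rewrite aug_scalar.
  by rewrite mulrDl -mulrA.
by rewrite mulrDr mulrCA.
Qed.

Lemma taugE a b : taug (a ⊗ b) = aug a * aug b.
Proof. exact: (tliftE _ _ (bilin_kbal taug_bilin)). Qed.

Fact taug1 : taug 1 = 1.
Proof. by rewrite -tpure1 taugE !aug1 mulr1. Qed.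

Fact taug_scalar : scalar taug.
Proof. exact: (tlift_linear taug_bilin). Qed.

Fact taugM : {morph taug : x y / x * y}.
Proof.
have taugD : {morph taug : x y / x + y}.
  by move=> x y; rewrite -{1}[x]scale1r taug_scalar mul1r.
move=> x y; elim/(@tens_ind K A B): x => [a b|x x' IH IH']; last first.
  by rewrite mulrDl !taugD mulrDl IH IH'.
elim/(@tens_ind K A B): y => [a' b'|y y' IH IH'].
  by rewrite tpureM !taugE !augM mulrACA.
by rewrite mulrDr !taugD mulrDr IH IH'.
Qed.

Fact tens_oner_neq0 : (1 : ktens A B) != 0.
Proof.
apply/eqP=> e; have : taug 0 = 0.
  by have := taug_scalar (-1) 0 0; rewrite !scaleN1r !addNr mulN1r addNr.
by rewrite -e taug1; apply/eqP; rewrite oner_neq0.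
Qed.

HB.instance Definition _ :=
  GRing.PzSemiRing_isNonZero.Build (ktens A B) tens_oner_neq0.
HB.instance Definition _ :=
  GRing.Lmodule_isLalgebra.Build K (ktens A B) (@tscalerAl K A B).
HB.instance Definition _ :=
  GRing.Lalgebra_isAlgebra.Build K (ktens A B) (@tscalerAr K A B).
HB.instance Definition _ :=
  Algebra_isAugmented.Build K (ktens A B) taug_scalar taug1 taugM.

End KTensorAug.

HB.mixin Record Vector_isLie (K : fieldType) L of Vector K L := {
  lie : L -> L -> L;
  lie_linearl : forall y, linear (lie^~ y);
  lie_linearr : forall x, linear (lie x);
  liexx : forall x, lie x x = 0;
  lie_jacobi : forall x y z,
    lie x (lie y z) + lie y (lie z x) + lie z (lie x y) = 0 }.

(* Finite-dimensional, since a [vectType] is. *)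
#[short(type="lieAlgType")]
HB.structure Definition LieAlgebra (K : fieldType) :=
  {L of Vector_isLie K L & Vector K L}.

(* [U L] is the unital associative [K]-algebra with generators [UGen x]
   ([x : L]) subject to linearity in [x] and [x y - y x = [x, y]]. *)

Section Enveloping.
Context {K : fieldType} (L : lieAlgType K).

Inductive uexp : Type :=
| UConst of K
| UGen of L
| UAdd of uexp & uexp
| UMul of uexp & uexp.

Inductive ueq : uexp -> uexp -> Prop :=
| ueq_refl a : ueq a a
| ueq_sym a b : ueq a b -> ueq b a
| ueq_trans b a c : ueq a b -> ueq b c -> ueq a c
| ueq_cgD a a' b b' : ueq a a' -> ueq b b' -> ueq (UAdd a b) (UAdd a' b')
| ueq_cgM a a' b b' : ueq a a' -> ueq b b' -> ueq (UMul a b) (UMul a' b')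
| ueq_addA a b c : ueq (UAdd a (UAdd b c)) (UAdd (UAdd a b) c)
| ueq_addC a b : ueq (UAdd a b) (UAdd b a)
| ueq_add0 a : ueq (UAdd (UConst 0) a) a
| ueq_mulA a b c : ueq (UMul a (UMul b c)) (UMul (UMul a b) c)
| ueq_mul1 a : ueq (UMul (UConst 1) a) a
| ueq_mulr1 a : ueq (UMul a (UConst 1)) a
| ueq_mul0 a : ueq (UMul (UConst 0) a) (UConst 0)
| ueq_mulDl a b c : ueq (UMul (UAdd a b) c) (UAdd (UMul a c) (UMul b c))
| ueq_mulDr a b c : ueq (UMul a (UAdd b c)) (UAdd (UMul a b) (UMul a c))
| ueq_constD s t : ueq (UConst (s + t)) (UAdd (UConst s) (UConst t))
| ueq_constM s t : ueq (UConst (s * t)) (UMul (UConst s) (UConst t))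
| ueq_constC s a : ueq (UMul (UConst s) a) (UMul a (UConst s))
| ueq_gen c x y :
    ueq (UGen (c *: x + y)) (UAdd (UMul (UConst c) (UGen x)) (UGen y))
| ueq_lie x y :
    ueq (UMul (UGen x) (UGen y)) (UAdd (UMul (UGen y) (UGen x)) (UGen (lie x y))).

HB.instance Definition _ := gen_eqMixin uexp.
HB.instance Definition _ := gen_choiceMixin uexp.

Definition urel a b := `[< ueq a b >].

Lemma urel_equiv : equiv_class_of urel.
Proof.
split=> [a|a b|b a c].
- by apply/asboolP; apply: ueq_refl.
- by apply/asboolP/asboolP; apply: ueq_sym.
- by move=> /asboolP h /asboolP h'; apply/asboolP; apply: ueq_trans h h'.
Qed.

Canonical u_equivrel := EquivRelPack urel_equiv.

Definition U := {eq_quot u_equivrel}.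

HB.instance Definition _ : EqQuotient _ u_equivrel U := EqQuotient.on U.
HB.instance Definition _ := Choice.on U.

Lemma u_piP (a b : uexp) : ueq a b <-> \pi_U a = \pi_U b.
Proof.
split; first by move=> h; apply/eqmodP/asboolP.
by move=> /eqmodP /asboolP.
Qed.

Lemma u_piW (P : U -> Prop) : (forall a, P (\pi_U a)) -> forall x, P x.
Proof. by move=> h x; rewrite -[x]reprK. Qed.

Lemma u_repr a : ueq (repr (\pi_U a)) a.
Proof. by apply/u_piP; rewrite reprK. Qed.

Definition u_add (x y : U) : U := \pi_U (UAdd (repr x) (repr y)).
Definition u_mul (x y : U) : U := \pi_U (UMul (repr x) (repr y)).
Definition u_const (c : K) : U := \pi_U (UConst c).
Definition u_opp (x : U) : U := u_mul (u_const (- 1)) x.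

Lemma u_addE a b : u_add (\pi_U a) (\pi_U b) = \pi_U (UAdd a b).
Proof. by apply/u_piP; apply: ueq_cgD; apply: u_repr. Qed.

Lemma u_mulE a b : u_mul (\pi_U a) (\pi_U b) = \pi_U (UMul a b).
Proof. by apply/u_piP; apply: ueq_cgM; apply: u_repr. Qed.

Fact u_addA : associative u_add.
Proof.
elim/u_piW=> a; elim/u_piW=> b; elim/u_piW=> c.
by rewrite !u_addE; apply/u_piP/ueq_addA.
Qed.

Fact u_addC : commutative u_add.
Proof.
by elim/u_piW=> a; elim/u_piW=> b; rewrite !u_addE; apply/u_piP/ueq_addC.
Qed.

Fact u_add0 : left_id (u_const 0) u_add.
Proof. by elim/u_piW=> a; rewrite u_addE; apply/u_piP/ueq_add0. Qed.

Fact u_mulA : associative u_mul.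
Proof.
elim/u_piW=> a; elim/u_piW=> b; elim/u_piW=> c.
by rewrite !u_mulE; apply/u_piP/ueq_mulA.
Qed.

Fact u_mul1 : left_id (u_const 1) u_mul.
Proof. by elim/u_piW=> a; rewrite u_mulE; apply/u_piP/ueq_mul1. Qed.

Fact u_mulr1 : right_id (u_const 1) u_mul.
Proof. by elim/u_piW=> a; rewrite u_mulE; apply/u_piP/ueq_mulr1. Qed.

Fact u_mul0 x : u_mul (u_const 0) x = u_const 0.
Proof. by elim/u_piW: x => a; rewrite u_mulE; apply/u_piP/ueq_mul0. Qed.

Fact u_mulDl : left_distributive u_mul u_add.
Proof.
elim/u_piW=> a; elim/u_piW=> b; elim/u_piW=> c.
by rewrite !(u_addE, u_mulE); apply/u_piP/ueq_mulDl.
Qed.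

Fact u_mulDr : right_distributive u_mul u_add.
Proof.
elim/u_piW=> a; elim/u_piW=> b; elim/u_piW=> c.
by rewrite !(u_addE, u_mulE); apply/u_piP/ueq_mulDr.
Qed.

Fact u_constD s t : u_const (s + t) = u_add (u_const s) (u_const t).
Proof. by rewrite u_addE; apply/u_piP/ueq_constD. Qed.

Fact u_constM s t : u_const (s * t) = u_mul (u_const s) (u_const t).
Proof. by rewrite u_mulE; apply/u_piP/ueq_constM. Qed.

Fact u_constC s x : u_mul (u_const s) x = u_mul x (u_const s).
Proof. by elim/u_piW: x => a; rewrite !u_mulE; apply/u_piP/ueq_constC. Qed.

Fact u_addN : left_inverse (u_const 0) u_opp u_add.
Proof.
move=> x; rewrite /u_opp -{2}[x]u_mul1 -u_mulDl -u_constD.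
by rewrite addNr u_mul0.
Qed.

HB.instance Definition _ := GRing.isZmodule.Build U u_addA u_addC u_add0 u_addN.

HB.instance Definition _ := GRing.Zmodule_isPzRing.Build U
  u_mulA u_mul1 u_mulr1 u_mulDl u_mulDr.

Definition u_scale (c : K) (x : U) : U := u_mul (u_const c) x.

Fact u_scaleA a b x : u_scale a (u_scale b x) = u_scale (a * b) x.
Proof. by rewrite /u_scale u_mulA u_constM. Qed.

Fact u_scaleDr : right_distributive u_scale +%R.
Proof. by move=> c x y; rewrite /u_scale u_mulDr. Qed.

Fact u_scaleDl x : {morph u_scale^~ x : a b / a + b}.
Proof. by move=> a b; rewrite /u_scale u_constD u_mulDl. Qed.

HB.instance Definition _ := GRing.Zmodule_isLmodule.Build K U
  u_scaleA u_mul1 u_scaleDr u_scaleDl.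

(* The inclusion of [L] in [U]. *)
Definition ugen (x : L) : U := \pi_U (UGen x).

Lemma ugen_linear : linear ugen.
Proof.
move=> c x y; transitivity (u_add (u_mul (u_const c) (ugen x)) (ugen y)) => //.
by rewrite u_mulE u_addE; apply/u_piP/ueq_gen.
Qed.

Lemma ugen_lie x y : ugen (lie x y) = ugen x * ugen y - ugen y * ugen x.
Proof.
apply/esym/eqP; rewrite subr_eq addrC; apply/eqP.
transitivity (\pi_U (UMul (UGen x) (UGen y))); first exact: u_mulE.
transitivity (u_add (u_mul (ugen y) (ugen x)) (ugen (lie x y))) => //.
by rewrite u_mulE u_addE; apply/u_piP/ueq_lie.
Qed.

Section Eval.
Context {A : algType K} (f : L -> A).

Fixpoint ueval (e : uexp) : A :=
  match e with
  | UConst c => c%:A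
  | UGen x => f x
  | UAdd a b => ueval a + ueval b
  | UMul a b => ueval a * ueval b
  end.

Definition lie_rep : Prop :=
  linear f /\ forall x y, f (lie x y) = f x * f y - f y * f x.

Lemma ueval_eq (fl : lie_rep) a b : ueq a b -> ueval a = ueval b.
Proof.
elim=> //=.
- by move=> {}b {}a c _ -> _ ->.
- by move=> {}a a' {}b b' _ -> _ ->.
- by move=> {}a a' {}b b' _ -> _ ->.
- by move=> *; rewrite addrA.
- by move=> *; rewrite addrC.
- by move=> *; rewrite scale0r add0r.
- by move=> *; rewrite mulrA.
- by move=> *; rewrite scale1r mul1r.
- by move=> *; rewrite scale1r mulr1.
- by move=> *; rewrite scale0r mul0r.
- by move=> *; rewrite mulrDl.
- by move=> *; rewrite mulrDr.
- by move=> *; rewrite scalerDl.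
- by move=> *; rewrite -scalerAl mul1r scalerA.
- by move=> *; rewrite -scalerAl -scalerAr mul1r mulr1.
- by move=> c x y; rewrite fl.1 -scalerAl mul1r.
- by move=> x y; rewrite fl.2 addrC subrK.
Qed.

End Eval.
End Enveloping.

(* The algebra morphism induced by [f]; see [ulift_gen] and
   [ulift_monoid_morphism]. *)
HB.lock Definition ulift (K : fieldType) (L : lieAlgType K) (A : algType K)
  (f : L -> A) (x : U L) : A := ueval f (repr x).

Canonical ulift_unlockable := Unlockable ulift.unlock.

Section Ulift.
Context {K : fieldType} {L : lieAlgType K} {A : algType K}.
Context (f : L -> A) (fl : lie_rep f).
Local Notation U := (U L).
Local Notation ulift := (ulift f).
Local Notation ueval := (ueval f).

Lemma ulift_pi e : ulift (\pi_U e) = ueval e.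
Proof. by rewrite unlock; apply: (ueval_eq fl); apply: u_repr. Qed.

Lemma ulift_gen x : ulift (ugen x) = f x.
Proof. exact: ulift_pi. Qed.

Lemma ulift_linear : linear ulift.
Proof.
move=> c; elim/(@u_piW K L)=> a; elim/(@u_piW K L)=> b.
transitivity (ulift (u_add (u_mul (u_const L c) (\pi_U a)) (\pi_U b))) => //.
by rewrite u_mulE u_addE !ulift_pi /= -scalerAl mul1r.
Qed.

Lemma ulift_monoid_morphism : monoid_morphism ulift.
Proof.
split; first by rewrite [LHS]ulift_pi /= scale1r.
elim/(@u_piW K L)=> a; elim/(@u_piW K L)=> b.
transitivity (ulift (u_mul (\pi_U a) (\pi_U b))) => //.
by rewrite u_mulE !ulift_pi.
Qed.

End Ulift.

Section EnvelopingAlg.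
Context {K : fieldType} (L : lieAlgType K).

Definition ucounit : U L -> K := ulift (fun _ : L => 0 : K^o).

Lemma lie_rep0 : lie_rep (fun _ : L => 0 : K^o).
Proof. by split=> [c x y|x y]; rewrite ?scaler0 ?mul0r ?addr0 ?subr0. Qed.

Fact ucounit_monoid : monoid_morphism ucounit.
Proof. exact: (ulift_monoid_morphism lie_rep0). Qed.

Fact ucounit_scalar : scalar ucounit.
Proof. exact: (ulift_linear lie_rep0). Qed.

Fact u_oner_neq0 : (1 : U L) != 0.
Proof.
apply/eqP=> e; have : ucounit 0 = 0.
  by have := ucounit_scalar (-1) 0 0; rewrite !scaleN1r !addNr mulN1r addNr.
by rewrite -e ucounit_monoid.1; apply/eqP; rewrite oner_neq0.
Qed.

HB.instance Definition _ := GRing.PzSemiRing_isNonZero.Build (U L) u_oner_neq0.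

Fact u_scalerAl (c : K) (x y : U L) : c *: (x * y) = (c *: x) * y.
Proof. exact: u_mulA. Qed.

HB.instance Definition _ := GRing.Lmodule_isLalgebra.Build K (U L) u_scalerAl.

Fact u_scalerAr (c : K) (x y : U L) : c *: (x * y) = x * (c *: y).
Proof.
transitivity (u_const L c * (x * y)) => //.
transitivity (x * (u_const L c * y)) => //.
by rewrite mulrA [_ * x]u_constC mulrA.
Qed.

HB.instance Definition _ := GRing.Lalgebra_isAlgebra.Build K (U L) u_scalerAr.
HB.instance Definition _ := Algebra_isAugmented.Build K (U L)
  ucounit_scalar ucounit_monoid.1 ucounit_monoid.2.

Lemma u_ind (P : U L -> Prop) :
  (forall c, P c%:A) -> (forall x, P (ugen x)) ->
  (forall x y, P x -> P y -> P (x + y)) ->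
  (forall x y, P x -> P y -> P (x * y)) -> forall x, P x.
Proof.
move=> Pc Pg PD PM; apply: u_piW; elim=> [c|x|a IHa b IHb|a IHa b IHb].
- suff -> : \pi_(U L) (UConst L c) = c%:A by [].
  exact/esym/u_mulr1.
- exact: Pg.
- suff -> : \pi_(U L) (UAdd a b) = \pi_(U L) a + \pi_(U L) b by apply: PD.
  exact/esym/u_addE.
- suff -> : \pi_(U L) (UMul a b) = \pi_(U L) a * \pi_(U L) b by apply: PM.
  exact/esym/u_mulE.
Qed.

Lemma ulift_unique (A : algType K) (f g : {lrmorphism U L -> A}) :
  (forall x, f (ugen x) = g (ugen x)) -> f =1 g.
Proof.
move=> fg; elim/u_ind => [c|x|x y IHx IHy|x y IHx IHy].
- by rewrite !linearZ !rmorph1.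
- exact: fg.
- by rewrite !rmorphD /= IHx IHy.
- by rewrite !rmorphM /= IHx IHy.
Qed.

End EnvelopingAlg.

HB.lock Definition tmap (K : fieldType) (V V' W W' : augAlgType K)
    (f : V -> V') (g : W -> W') : (V ⊗ W)%type -> (V' ⊗ W')%type :=
  tlift (fun v w => f v ⊗ g w).

Arguments tmap {K V V' W W'} f g.

Canonical tmap_unlockable := Unlockable tmap.unlock.

HB.lock Definition tassoc (K : fieldType) (V W X : augAlgType K) :
    (V ⊗ (W ⊗ X))%type -> (V ⊗ W ⊗ X)%type :=
  tlift (fun v => tlift (fun w x => v ⊗ w ⊗ x)).

Arguments tassoc {K V W X}.

Canonical tassoc_unlockable := Unlockable tassoc.unlock.

Section TensorMaps.
Context {K : fieldType}.

Section Tmap.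
Context (A A' B B' : augAlgType K).
Context (f : {lrmorphism A -> A'}) (g : {lrmorphism B -> B'}).

Lemma tmap_bilin : bilin (fun a b => f a ⊗ g b).
Proof.
split=> [w c v v'|v c w w']; rewrite linearP.
  by rewrite tpureDl tpureZl.
by rewrite tpureDr tpureZr.
Qed.

Lemma tmapE a b : tmap f g (a ⊗ b) = f a ⊗ g b.
Proof. by rewrite unlock; apply: (tliftE _ _ (bilin_kbal tmap_bilin)). Qed.

Fact tmap_linear : linear (tmap f g).
Proof. by rewrite unlock; apply: (tlift_linear tmap_bilin). Qed.

HB.instance Definition _ :=
  GRing.isLinear.Build K (ktens A B) (ktens A' B') *:%R (tmap f g) tmap_linear.

Fact tmap_monoid_morphism : monoid_morphism (tmap f g).
Proof.
split; first by rewrite -tpure1 tmapE !rmorph1.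
move=> x y; elim/(@tens_ind K A B): x => [a b|x x' IH IH']; last first.
  by rewrite mulrDl !linearD /= mulrDl IH IH'.
elim/(@tens_ind K A B): y => [a' b'|y y' IH IH']; last first.
  by rewrite mulrDr !linearD /= mulrDr IH IH'.
by rewrite tpureM !tmapE tpureM !rmorphM.
Qed.

HB.instance Definition _ :=
  GRing.isMonoidMorphism.Build (ktens A B) (ktens A' B') (tmap f g)
    tmap_monoid_morphism.
End Tmap.

Section Tassoc.
Context (A B C : augAlgType K).

Lemma tassoc_bilin2 a : bilin (fun (b : B) (c : C) => (a : A) ⊗ b ⊗ c).
Proof.
split=> [w c v v'|v c w w'].
  by rewrite tpureDr tpureZr tpureDl tpureZl.
by rewrite tpureDr tpureZr.
Qed.

Lemma tassoc_bilin :
  bilin (fun (a : A) => tlift (fun (b : B) (c : C) => a ⊗ b ⊗ c)).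
Proof.
have k2 a := bilin_kbal (tassoc_bilin2 a).
split=> [w c v v'|v c w w']; last exact: (tlift_linear (tassoc_bilin2 v)).
elim/(@tens_ind K B C): w => [b d|x y IHx IHy].
  by rewrite !(tliftE _ _ (k2 _)) tpureDl tpureZl tpureDl tpureZl.
by rewrite !(tliftD (k2 _)) IHx IHy scalerDr addrACA.
Qed.

Lemma tassocE (a : A) (b : B) (c : C) : tassoc (a ⊗ (b ⊗ c)) = a ⊗ b ⊗ c.
Proof.
rewrite unlock (tliftE _ _ (bilin_kbal tassoc_bilin)).
exact: (tliftE _ _ (bilin_kbal (tassoc_bilin2 a))).
Qed.

Fact tassoc_linear : linear (@tassoc K A B C).
Proof. by rewrite unlock; apply: (tlift_linear tassoc_bilin). Qed.

HB.instance Definition _ := GRing.isLinear.Build K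
  (ktens A (ktens B C)) (ktens (ktens A B) C) *:%R (@tassoc K A B C) tassoc_linear.

Lemma tens3_ind (P : (A ⊗ (B ⊗ C))%type -> Prop) :
  (forall a b c, P (a ⊗ (b ⊗ c))) -> (forall x y, P x -> P y -> P (x + y)) ->
  forall x, P x.
Proof.
move=> Pp PD; elim/(@tens_ind K A (ktens B C)) => // a.
by elim/(@tens_ind K B C) => // x y IHx IHy; rewrite tpureDr; apply: PD.
Qed.

Fact tassoc_monoid_morphism : monoid_morphism (@tassoc K A B C).
Proof.
split; first exact: (tassocE 1 1 1).
move=> x y; elim/tens3_ind: x => [a b c|x x' IH IH']; last first.
  by rewrite mulrDl !linearD /= mulrDl IH IH'.
elim/tens3_ind: y => [a' b' c'|y y' IH IH']; last first.
  by rewrite mulrDr !linearD /= mulrDr IH IH'.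
by rewrite !tpureM !tassocE !tpureM.
Qed.

HB.instance Definition _ := GRing.isMonoidMorphism.Build
  (ktens A (ktens B C)) (ktens (ktens A B) C) (@tassoc K A B C)
  tassoc_monoid_morphism.
End Tassoc.
End TensorMaps.

Section Coproduct.
Context {K : fieldType} (L : lieAlgType K).
Local Notation H := (U L).

Definition Delta_gen (x : L) : (H ⊗ H)%type := ugen x ⊗ 1 + 1 ⊗ ugen x.

Lemma Delta_gen_rep : lie_rep Delta_gen.
Proof.
split=> [c x y|x y]; rewrite /Delta_gen.
  by rewrite ugen_linear tpureDl tpureDr tpureZl tpureZr scalerDr addrACA.
rewrite ugen_lie !mulrDl !mulrDr !tpureM !mulr1 !mul1r.
rewrite -scaleN1r tpureDl tpureDr tpureZl tpureZr !scaleN1r.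
have aux (V : zmodType) (a b c d e f : V) :
    a - c + (b - d) = a + e + (f + b) - (c + f + (e + d)).
  rewrite [f + b]addrC [a + e + _]addrACA [e + d]addrC [c + f + _]addrACA [f + e]addrC.
  by rewrite opprD [RHS]addrACA subrr addr0 opprD addrACA.
exact: aux.
Qed.

Definition Delta : H -> (H ⊗ H)%type := ulift Delta_gen.

HB.instance Definition _ := GRing.isLinear.Build K H (ktens H H) *:%R Delta
  (ulift_linear Delta_gen_rep).
HB.instance Definition _ := GRing.isMonoidMorphism.Build H (ktens H H) Delta
  (ulift_monoid_morphism Delta_gen_rep).

Lemma DeltaE x : Delta (ugen x) = ugen x ⊗ 1 + 1 ⊗ ugen x.
Proof. exact: (ulift_gen Delta_gen_rep). Qed.

(* [Δ ⊗ id] and [id ⊗ Δ], with values in [H ⊗ H ⊗ H = (H ⊗ H) ⊗ H]. *)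
Definition Delta_id : (H ⊗ H)%type -> (H ⊗ H ⊗ H)%type := tmap Delta idfun.
Definition id_Delta : (H ⊗ H)%type -> (H ⊗ H ⊗ H)%type :=
  @tassoc K H H H \o tmap idfun Delta.

Fact Delta_id_linear : linear Delta_id.
Proof. exact: (tmap_linear Delta idfun). Qed.

Fact Delta_id_monoid_morphism : monoid_morphism Delta_id.
Proof. exact: (tmap_monoid_morphism Delta idfun). Qed.

HB.instance Definition _ := GRing.isLinear.Build K
  (ktens H H) (ktens (ktens H H) H) *:%R Delta_id Delta_id_linear.
HB.instance Definition _ := GRing.isMonoidMorphism.Build
  (ktens H H) (ktens (ktens H H) H) Delta_id Delta_id_monoid_morphism.

Fact id_Delta_linear : linear id_Delta.
Proof.
move=> c x y.
exact: etrans (congr1 _ (tmap_linear (@idfun H) Delta c x y))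
  (tassoc_linear _ _ _).
Qed.

Fact id_Delta_monoid_morphism : monoid_morphism id_Delta.
Proof.
have [t1 tM] := tmap_monoid_morphism (@idfun H) Delta.
have [a1 aM] := tassoc_monoid_morphism H H H.
split=> [|x y]; first exact: etrans (congr1 _ t1) a1.
exact: etrans (congr1 _ (tM x y)) (aM _ _).
Qed.

HB.instance Definition _ := GRing.isLinear.Build K
  (ktens H H) (ktens (ktens H H) H) *:%R id_Delta id_Delta_linear.
HB.instance Definition _ := GRing.isMonoidMorphism.Build
  (ktens H H) (ktens (ktens H H) H) id_Delta id_Delta_monoid_morphism.

Definition Delta3 : H -> (H ⊗ H ⊗ H)%type := Delta_id \o Delta.

HB.instance Definition _ := GRing.LRMorphism.on Delta3.

Lemma Delta_idE a b : Delta_id (a ⊗ b) = Delta a ⊗ b.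
Proof. exact: (tmapE Delta idfun). Qed.

Lemma id_DeltaE a b : id_Delta (a ⊗ b) = tassoc (a ⊗ Delta b).
Proof. exact: congr1 _ (tmapE idfun Delta a b). Qed.

Lemma coassoc h : id_Delta (Delta h) = Delta3 h.
Proof.
apply: (ulift_unique (f := id_Delta \o Delta) (g := Delta3)) => x.
rewrite /= /Delta3 /= DeltaE !linearD /= !Delta_idE !id_DeltaE DeltaE rmorph1.
rewrite -tpure1 tassocE tpureDr linearD /= !tassocE tpureDl.
exact: addrA.
Qed.

End Coproduct.

Arguments Delta {K L}.
Arguments Delta_id {K L}.
Arguments id_Delta {K L}.
Arguments Delta3 {K L}.

(* [T ⊗_H A], for [T] a right [H]-module via [α·h = α * D h]; [T] acts on it
   by left multiplication on the first factor. *)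
Section HTensor.
Context {H T : pzRingType} (D : H -> T) (A : lmodType H).

Definition hract (a : T) (h : H) : T := a * D h.
Definition hlact (h : H) (c : A) : A := h *: c.
Definition htens := btensor hract hlact.

HB.instance Definition _ := GRing.Zmodule.on htens.

Definition hpure (a : T) (c : A) : htens := bt_pure hract hlact a c.

Lemma hpureDl a a' c : hpure (a + a') c = hpure a c + hpure a' c.
Proof. exact: bt_pureDl. Qed.

Lemma hpureDr a c c' : hpure a (c + c') = hpure a c + hpure a c'.
Proof. exact: bt_pureDr. Qed.

Lemma hpureM a h c : hpure (a * D h) c = hpure a (h *: c).
Proof. exact: (bt_pure_bal hract hlact). Qed.

Lemma htens_ind (P : htens -> Prop) :
  (forall a c, P (hpure a c)) -> (forall x y, P x -> P y -> P (x + y)) ->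
  forall x, P x.
Proof. exact: bt_ind. Qed.

Definition hlift (Z : zmodType) (f : T -> A -> Z) : htens -> Z :=
  bt_lift f.

Definition hscale (b : T) : htens -> htens := hlift (fun a c => hpure (b * a) c).

Lemma hscale_bal b : balanced hract hlact (fun a c => hpure (b * a) c).
Proof.
split=> [a a' c|a c c'|a h c].
- by rewrite mulrDr hpureDl.
- exact: hpureDr.
- by rewrite /hract mulrA hpureM.
Qed.

Lemma hscaleE b a c : hscale b (hpure a c) = hpure (b * a) c.
Proof. exact: (bt_liftE (hscale_bal b)). Qed.

Fact hscaleDr : right_distributive hscale +%R.
Proof. by move=> b; apply: (bt_liftD (hscale_bal b)). Qed.

Fact hscaleA a b x : hscale a (hscale b x) = hscale (a * b) x.
Proof.
elim/htens_ind: x => [t c|x y IHx IHy]; last by rewrite !hscaleDr IHx IHy.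
by rewrite !hscaleE mulrA.
Qed.

Fact hscale1 : left_id 1 hscale.
Proof.
elim/htens_ind => [t c|x y IHx IHy]; last by rewrite !hscaleDr IHx IHy.
by rewrite hscaleE mul1r.
Qed.

Fact hscaleDl x : {morph hscale^~ x : a b / a + b}.
Proof.
move=> a b; elim/htens_ind: x => [t c|x y IHx IHy] /=.
  by rewrite !hscaleE mulrDl hpureDl.
by rewrite !hscaleDr IHx IHy addrACA.
Qed.

HB.instance Definition _ := GRing.Zmodule_isLmodule.Build T htens
  hscaleA hscale1 hscaleDr hscaleDl.

Lemma hpureZ b a c : b *: hpure a c = hpure (b * a) c.
Proof. exact: hscaleE. Qed.

End HTensor.

Arguments hpure {H T D A} a c.
Notation "a ⊗_H c" := (hpure a c) : ring_scope.

Section Pseudoalgebra.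
Context {K : fieldType} {L : lieAlgType K} (A : lmodType (U L)).
Local Notation H := (U L).

(* [(H ⊗ H) ⊗_H A] and [(H ⊗ H ⊗ H) ⊗_H A]. *)
Definition H2tens := htens (@Delta K L) A.
Definition H3tens := htens (@Delta3 K L) A.

Record is_pseudoalgebra (ast : A -> A -> H2tens) : Prop := IsPseudoalgebra {
  pa_Dl : forall x x' y, ast (x + x') y = ast x y + ast x' y;
  pa_Dr : forall x y y', ast x (y + y') = ast x y + ast x y';
  pa_bilinear : forall (h g : H) x y,
    ast (h *: x) (g *: y) = ((h ⊗ g : H ⊗ H) *: ast x y) }.

(* [α ⊗_H c ↦ (Δ ⊗ id)(α) ⊗_H c] and [α ⊗_H c ↦ (id ⊗ Δ)(α) ⊗_H c]. *)
Definition expandl : H2tens -> H3tens :=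
  hlift (fun a c => Delta_id a ⊗_H c).
Definition expandr : H2tens -> H3tens :=
  hlift (fun a c => id_Delta a ⊗_H c).

Lemma expandl_bal : balanced (hract Delta) (@hlact H A)
  (fun a c => Delta_id a ⊗_H c : H3tens).
Proof.
split=> [a a' c|a c c'|a h c].
- by rewrite linearD hpureDl.
- exact: hpureDr.
- by rewrite /hract rmorphM /= -hpureM.
Qed.

Lemma expandr_bal : balanced (hract Delta) (@hlact H A)
  (fun a c => id_Delta a ⊗_H c : H3tens).
Proof.
split=> [a a' c|a c c'|a h c].
- by rewrite linearD hpureDl.
- exact: hpureDr.
- by rewrite /hract rmorphM /= coassoc -hpureM.
Qed.

Lemma expandlE a c : expandl (a ⊗_H c) = Delta_id a ⊗_H c.
Proof. exact: (bt_liftE expandl_bal). Qed.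

Lemma expandrE a c : expandr (a ⊗_H c) = id_Delta a ⊗_H c.
Proof. exact: (bt_liftE expandr_bal). Qed.

Lemma expandlD : {morph expandl : u v / u + v}.
Proof. exact: (bt_liftD expandl_bal). Qed.

Lemma expandrD : {morph expandr : u v / u + v}.
Proof. exact: (bt_liftD expandr_bal). Qed.

Lemma expandlZ (b : H ⊗ H) u : expandl (b *: u) = Delta_id b *: expandl u.
Proof.
elim/(@htens_ind H (ktens H H) Delta A): u => [a c|u v IHu IHv].
  by rewrite hpureZ !expandlE rmorphM hpureZ.
by rewrite scalerDr !expandlD IHu IHv scalerDr.
Qed.

Lemma expandrZ (b : H ⊗ H) u : expandr (b *: u) = id_Delta b *: expandr u.
Proof.
elim/(@htens_ind H (ktens H H) Delta A): u => [a c|u v IHu IHv].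
  by rewrite hpureZ !expandrE rmorphM hpureZ.
by rewrite scalerDr !expandrD IHu IHv scalerDr.
Qed.

Context (ast : A -> A -> H2tens).

(* [u ∗ z] for [u ∈ (H ⊗ H) ⊗_H A], and [x ∗ v] for [v ∈ (H ⊗ H) ⊗_H A]. *)
Definition astl (u : H2tens) (z : A) : H3tens :=
  hlift (fun (b : H ⊗ H) x => (b ⊗ (1 : H)) *: expandl (ast x z)) u.
Definition astr (x : A) (v : H2tens) : H3tens :=
  hlift (fun (b : H ⊗ H) y => tassoc ((1 : H) ⊗ b) *: expandr (ast x y)) v.

Definition pseudo_associative : Prop :=
  forall x y z, astl (ast x y) z = astr x (ast y z).

Section Wf.
Context (past : is_pseudoalgebra ast).

Lemma astl_bal z : balanced (hract Delta) (@hlact H A)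
  (fun (b : H ⊗ H) x => (b ⊗ (1 : H)) *: expandl (ast x z)).
Proof.
split=> [b b' x|b x x'|b h x].
- by rewrite tpureDl scalerDl.
- by rewrite (pa_Dl past) expandlD scalerDr.
- rewrite /hlact -{2}[z]scale1r (pa_bilinear past) expandlZ Delta_idE.
  by rewrite scalerA tpureM mulr1.
Qed.

Lemma astr_bal x : balanced (hract Delta) (@hlact H A)
  (fun (b : H ⊗ H) y => tassoc ((1 : H) ⊗ b) *: expandr (ast x y)).
Proof.
split=> [b b' y|b y y'|b h y].
- by rewrite tpureDr linearD scalerDl.
- by rewrite (pa_Dr past) expandrD scalerDr.
- rewrite /hlact -{2}[x]scale1r (pa_bilinear past) expandrZ id_DeltaE.
  by rewrite scalerA -rmorphM tpureM mulr1.
Qed.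

Lemma astlE (b : H ⊗ H) x z :
  astl (b ⊗_H x) z = (b ⊗ (1 : H)) *: expandl (ast x z).
Proof. exact: (bt_liftE (astl_bal z)). Qed.

Lemma astrE x (b : H ⊗ H) y :
  astr x (b ⊗_H y) = tassoc ((1 : H) ⊗ b) *: expandr (ast x y).
Proof. exact: (bt_liftE (astr_bal x)). Qed.

Lemma astlD z : {morph astl^~ z : u v / u + v}.
Proof. exact: (bt_liftD (astl_bal z)). Qed.

Lemma astrD x : {morph astr x : u v / u + v}.
Proof. exact: (bt_liftD (astr_bal x)). Qed.
End Wf.

End Pseudoalgebra.

(* [P] is free of rank two with basis [e1], [e2]. *)
Definition is_basis2 (H : pzRingType) (P : lmodType H) (e1 e2 : P) : Prop :=
  bijective (fun h : H * H => h.1 *: e1 + h.2 *: e2).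

(* Main.v *)
Require Import Defs.
From HB Require Import structures.
From mathcomp Require Import all_boot all_order all_algebra.
From mathcomp Require Import boolp.
From mathcomp Require classical_sets.
From mathcomp Require Import mpoly.

Set Implicit Arguments.
Unset Strict Implicit.
Unset Printing Implicit Defensive.

Import GRing.Theory.
Local Open Scope ring_scope.

(** Write [e1 ∗ e2 = a ⊗_H e1 + b ⊗_H e2], and rescale so that [t1 = t2 = 1].
    Comparing coordinates, associativity on [(e1, e1, e2)] and [(e1, e2, e2)]
    reads

      (Δ ⊗ id) b = (1 ⊗ b) (id ⊗ Δ) b,
      (Δ ⊗ id) a = 1 ⊗ a + (1 ⊗ b) (id ⊗ Δ) a,
      (a ⊗ 1) (Δ ⊗ id) a = (id ⊗ Δ) a,
      (a ⊗ 1) (Δ ⊗ id) b + b ⊗ 1 = (id ⊗ Δ) b.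

    The heart of the proof is that the first equation has only the solutions
    [b = 0] and [b = 1] ([cocycle01]).  If [b = 1], the last equation gives
    [a = 0].  If [b = 0], the second one says that [a = 1 ⊗ g] and the third
    one that [g] is group-like, so [a] is 0 or 1 ([cocycle_left]).  Hence
    [e1 ∗ e2] is [0], [t2 ⊗ 1 ⊗_H e1] or [t1 ⊗ 1 ⊗_H e2] ([mixed_product]), and
    by symmetry so is [e2 ∗ e1].  Of the nine combinations, the triples
    [(e1, e2, e1)] and [(e2, e1, e2)] exclude four ([mixed_scalars]); the other
    five are associative because the structure constants form an associative
    multiplication table ([table_associative]).

    The solutions of the cocycle equation are found by a degree argument.  In
    [U L], filtered by word length, degrees add under multiplication
    ([ufiltM_lt]), and contracting one leg of [Δ h] with a functional does not
    raise the degree of [h].  Put [g = (ε ⊗ id) b] and [f = (id ⊗ ε) b].  Counits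
    applied to the equation give [b = (1 ⊗ g) b], so that [g] is idempotent,
    hence 0 or 1, and [(1 ⊗ f) b = Δ f].  If [g = 0] then [b = 0].  If [g = 1]
    then [f != 0], and contracting the first leg of [(1 ⊗ f) b = Δ f] with a
    functional [eta] shows that [f * (eta ⊗ id) b] has degree at most that of
    [f], so [(eta ⊗ id) b] is a scalar.  Therefore [b = f ⊗ 1] with [f]
    group-like, and [f = 1] by comparing degrees again.

    That degrees add would follow from the Poincaré-Birkhoff-Witt theorem, but
    it can be read off from the coproduct.  Let [x_i] be elements of [L] whose
    images form a basis of the image of [L] in [U L], and let [xi_i] be
    functionals on [U L] that vanish at 1 and give the coordinates of that
    image.  The operators [∂_i = (xi_i ⊗ id) Δ] lower the degree, and up to lower
    degree they obey the Leibniz rule for multiplication by a generator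
    ([contract_leibniz]) and Euler's identity [Σ x_i ∂_i h = n h] in degree [n]
    ([euler]).  Iterating [∂ = Σ X_i ∂_i], with [X_i] the indeterminates, yields a
    symbol in [K[X_1, .., X_d]].  It is multiplicative on leading terms
    ([symbM]), and in characteristic 0 Euler's identity makes it vanish in
    degree [n] only on elements of lower degree ([symb_inj]); and the polynomial
    ring is a domain. *)

(** * Linear functionals *)

Definition functional (K : fieldType) (V : lmodType K) (f : V -> K)
  (fl : scalar f) : {scalar V} :=
  HB.pack f (GRing.isLinear.Build K V K *%R f fl).

Section Functionals.
Context {K : fieldType} {V : lmodType K}.

(** A maximal subspace avoiding [v] is a hyperplane, by Zorn's lemma. *)
Lemma scalar_separates (v : V) : v != 0 -> exists f : {scalar V}, f v = 1.
Proof.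
move=> v0.
pose closed (X : V -> Prop) := forall c x y, X x -> X y -> X (c *: x + y).
have [|A [[Acl Av] Amax]] :=
    @classical_sets.Zorn_bigcup V (fun X => closed X /\ ~ X v).
  move=> F FP Ftot; split=> [c x y [X FX Xx] [Y FY Yy]|[X FX]]; last first.
    by have [_] := FP _ FX.
  have [XY|YX] := Ftot _ _ FX FY.
  - by exists Y => //; apply: (FP _ FY).1 => //; apply: XY.
  - by exists X => //; apply: (FP _ FX).1 => //; apply: YX.
(* The closure condition also holds for the empty set, hence [A0]. *)
pose A0 x := x = 0 \/ A x.
have A0cl : closed A0.
  move=> c x y [->|Ax] [->|Ay]; rewrite /A0 ?scaler0 ?addr0; try by left.
  - by rewrite add0r; right.
  - right; rewrite -[c *: x]addr0; apply: (Acl) => //.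
    by rewrite -(addNr x) -scaleN1r; apply: Acl.
  - by right; apply: Acl.
have A0v : ~ A0 v by case=> // /eqP; rewrite (negPf v0).
have A0Z c x : A0 x -> A0 (c *: x).
  by move=> Ax; rewrite -[c *: x]addr0; apply: A0cl => //; left.
have A0B x y : A0 x -> A0 y -> A0 (x - y).
  by move=> Ax Ay; rewrite addrC -scaleN1r; apply: A0cl.
have dec x : exists c, A0 (x - c *: v).
  have [Ax|Ax] := pselect (A0 x); first by exists 0; rewrite scale0r subr0.
  pose B y := exists a c, A0 a /\ y = a + c *: x.
  have : ~ (closed B /\ ~ B v).
    apply: Amax; split; last first.
      move=> BA; apply: Ax; right; apply: BA.
      by exists 0, 1; split; [left | rewrite add0r scale1r].
    by move=> a Aa; exists a, 0; split; [right | rewrite scale0r addr0].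
  have Bcl : closed B.
    move=> c _ _ [a [s [Aa ->]]] [b [t [Ab ->]]].
    exists (c *: a + b), (c * s + t); split; first exact: A0cl.
    by rewrite scalerDr scalerA scalerDl addrACA.
  move=> nB; have [a [c [Aa ve]]] : B v by apply: contrapT => nBv; apply: nB.
  have c0 : c != 0.
    by apply/eqP=> c0; apply: A0v; rewrite ve c0 scale0r addr0.
  exists c^-1; rewrite ve scalerDr scalerA mulVf // scale1r opprD addrCA subrr.
  by rewrite addr0 -scaleNr; apply: A0Z.
have uniq x c d : A0 (x - c *: v) -> A0 (x - d *: v) -> c = d.
  move=> h1 h2; apply/eqP; rewrite -subr_eq0; apply/negPn/negP => cd0.
  apply: A0v; rewrite -[v]scale1r -(mulVf cd0) -scalerA; apply: A0Z.
  by have := A0B _ _ h2 h1; rewrite opprB addrC addrA subrK -scalerBl.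
have {dec} [f Af] := choice dec.
have fl : scalar f.
  move=> c x y; apply: (uniq (c *: x + y)); first exact: Af.
  rewrite scalerDl -scalerA opprD addrACA -scalerBr.
  exact: A0cl.
exists (functional fl); apply: (uniq v); first exact: Af.
by rewrite scale1r subrr; left.
Qed.

(** Gram-Schmidt with functionals instead of an inner product: each new vector
    is corrected by its components along the previous ones and, if the result
    is nonzero, a functional separating it from 0 is corrected in turn. *)
Lemma dual_system (s : seq V) (S : V -> Prop) :
  (forall c u v, S u -> S v -> S (c *: u + v)) ->
  (forall v, v \in s -> S v) ->
  exists d (x : 'I_d -> V) (xi : 'I_d -> {scalar V}),
  [/\ forall i j, xi i (x j) = (i == j)%:R, forall i, S (x i) &
      forall v, v \in s -> v = \sum_i xi i v *: x i].
Proof.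
move=> Scl; elim: s => [|v s IHs] Ss.
  exists 0%N, (fun=> 0), (fun=> \0); split=> // i; first by case: i.
  by case: i.
case: IHs => [u us|d [x [xi [dual Sx span]]]].
  by apply: Ss; rewrite inE us orbT.
have Sv : S v by apply: Ss; rewrite inE eqxx.
pose w := v - \sum_i xi i v *: x i.
have Sw : S w.
  rewrite /w -sumrN; elim/big_rec: _ => [|i u _ Su]; first by rewrite addr0.
  by rewrite addrCA -scaleNr; apply: Scl.
have [/eqP w0|/scalar_separates[eta etaw]] := boolP (w == 0).
  exists d, x, xi; split=> // u; rewrite inE => /predU1P[->|/span //].
  by apply/eqP; rewrite -subr_eq0; apply/eqP.
have xiw i : xi i w = 0.
  rewrite linearB linear_sum /= (bigD1 i) //= linearZ /= dual eqxx mulr1.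
  rewrite big1 ?addr0 ?subrr // => j ji.
  by rewrite linearZ /= dual eq_sym (negPf ji) mulr0.
pose zeta u := eta u - \sum_i eta (x i) * xi i u.
have zl : scalar zeta.
  move=> c u u'; rewrite /zeta linearP mulrBr mulr_sumr addrACA -opprD -big_split.
  by congr (_ - _); apply: eq_bigr => i _; rewrite linearP mulrDr mulrCA.
pose y i := oapp x w (unlift ord0 i).
pose nu i := oapp xi (functional zl) (unlift ord0 i).
exists d.+1, y, nu.
have zx j : zeta (x j) = 0.
  rewrite /zeta (bigD1 j) //= dual eqxx mulr1 big1 ?addr0 ?subrr // => i ij.
  by rewrite dual (negPf ij) mulr0.
have zw : zeta w = 1.
  by rewrite /zeta big1 ?subr0 ?etaw // => i _; rewrite xiw mulr0.
split=> [i j|i|u].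
- rewrite /nu /y; case: (unliftP ord0 i) => [? ->|->];
    by case: (unliftP ord0 j) => [? ->|->] //=.
- by rewrite /y; case: (unliftP ord0 i) => [? _|_] /=.
have sumE : \sum_i nu i u *: y i = zeta u *: w + \sum_i xi i u *: x i.
  rewrite big_ord_recl /nu /y unlift_none; congr (_ + _).
  by apply: eq_bigr => i _; rewrite liftK.
have zetaE : zeta =1 functional zl by [].
rewrite sumE inE => /predU1P[->|us].
  have -> : zeta v = 1.
    apply/eqP; rewrite -subr_eq0 -zw !zetaE -linearB opprB addrC subrK.
    by rewrite linear_sum big1 // => i _; rewrite linearZ -zetaE zx /= mulr0.
  by rewrite scale1r subrK.
suff -> : zeta u = 0 by rewrite scale0r add0r; apply: span.
rewrite zetaE {1}(span u us) linear_sum big1 // => i _.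
by rewrite linearZ -zetaE zx /= mulr0.
Qed.

End Functionals.

Lemma augD (K : fieldType) (A : augAlgType K) : {morph @aug K A : x y / x + y}.
Proof. by move=> x y; rewrite -{1}[x]scale1r aug_scalar mul1r. Qed.

Lemma augZ (K : fieldType) (A : augAlgType K) c (x : A) : aug (c *: x) = c * aug x.
Proof. by rewrite -[LHS]/(functional (@aug_scalar K A) _) linearZ. Qed.

Lemma aug_const (K : fieldType) (A : augAlgType K) (c : K) : aug (c%:A : A) = c.
Proof. by rewrite augZ aug1 mulr1. Qed.

(** * Slices of tensors *)

Section Slices.
Context {K : fieldType} (A B : augAlgType K).
Implicit Types (f : {scalar A}) (u : ktens A B).

Definition slice f : ktens A B -> B := tlift (fun a b => f a *: b).

Lemma slice_bilin f : bilin (fun (a : A) (b : B) => f a *: b).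
Proof.
split=> [b c a a'|a c b b']; first by rewrite linearP scalerDl scalerA.
by rewrite scalerDr !scalerA mulrC.
Qed.

Lemma sliceE f a b : slice f (a ⊗ b) = f a *: b.
Proof. exact: (tliftE _ _ (bilin_kbal (slice_bilin f))). Qed.

Fact slice_linear f : linear (slice f).
Proof. exact: (tlift_linear (slice_bilin f)). Qed.

HB.instance Definition _ f :=
  GRing.isLinear.Build K (ktens A B) B *:%R (slice f) (slice_linear f).

Lemma tpure0r (a : A) : a ⊗ (0 : B) = 0.
Proof. by rewrite -(scale0r 0) tpureZr !scale0r. Qed.

Lemma tpure0l (b : B) : (0 : A) ⊗ b = 0.
Proof. by rewrite -(scale0r 0) tpureZl !scale0r. Qed.

Lemma tpure_sumr I (r : seq I) (a : A) (F : I -> B) :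
  a ⊗ (\sum_(i <- r) F i) = \sum_(i <- r) (a ⊗ F i).
Proof. exact: (big_morph _ (tpureDr a) (tpure0r a)). Qed.

Lemma tpure_suml I (r : seq I) (F : I -> A) (b : B) :
  (\sum_(i <- r) F i) ⊗ b = \sum_(i <- r) (F i ⊗ b).
Proof.
exact: (big_morph (fun a => a ⊗ b) (fun a a' => tpureDl a a' b) (tpure0l b)).
Qed.

Lemma tens_sum u : exists s : seq (A * B), u = \sum_(p <- s) (p.1 ⊗ p.2).
Proof.
elim/(@tens_ind K A B): u => [a b|u v [s ->] [t ->]].
  by exists [:: (a, b)]; rewrite big_seq1.
by exists (s ++ t); rewrite big_cat.
Qed.

(** The first legs of a tensor can be expanded along a finite dual system;
    the coefficients of the expansion are slices. *)
Lemma slice_ext0 u : (forall f, slice f u = 0) -> u = 0.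
Proof.
have [s ->] := tens_sum u => fu.
have [] // := @dual_system K A [seq p.1 | p <- s] (fun=> True).
move=> d [x [xi [_ _ span]]].
rewrite (eq_big_seq (fun p => \sum_i (x i ⊗ (xi i p.1 *: p.2)))) => [|p sp].
  rewrite exchange_big big1 //= => i _; rewrite -tpure_sumr.
  have := fu (xi i); rewrite linear_sum.
  by under eq_bigr do rewrite /= sliceE; move=> ->; rewrite tpure0r.
rewrite {1}(span p.1 (map_f fst sp)) tpure_suml.
by apply: eq_bigr => i _; rewrite tpureC.
Qed.

(** [ε ⊗ id] and [id ⊗ ε]. *)
Definition augl : ktens A B -> B := slice (functional (@aug_scalar K A)).
Definition augr : ktens A B -> A := tlift (fun a b => aug b *: a).

Lemma auglE a b : augl (a ⊗ b) = aug a *: b.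
Proof. exact: sliceE. Qed.

Lemma augr_bilin : bilin (fun (a : A) (b : B) => aug b *: a).
Proof.
split=> [b c a a'|a c b b']; first by rewrite scalerDr !scalerA mulrC.
by rewrite aug_scalar scalerDl scalerA.
Qed.

Lemma augrE a b : augr (a ⊗ b) = aug b *: a.
Proof. exact: (tliftE _ _ (bilin_kbal augr_bilin)). Qed.

Fact augl_linear : linear augl.
Proof. exact: slice_linear. Qed.

Fact augr_linear : linear augr.
Proof. exact: (tlift_linear augr_bilin). Qed.

HB.instance Definition _ :=
  GRing.isLinear.Build K (ktens A B) B *:%R augl augl_linear.
HB.instance Definition _ :=
  GRing.isLinear.Build K (ktens A B) A *:%R augr augr_linear.

Fact augl_monoid : monoid_morphism augl.
Proof.
split=> [|u v]; first by rewrite -tpure1 auglE aug1 scale1r.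
elim/(@tens_ind K A B): u => [a b|u u' IH IH']; last first.
  by rewrite mulrDl !linearD /= mulrDl IH IH'.
elim/(@tens_ind K A B): v => [c e|v v' IH IH']; last first.
  by rewrite mulrDr !linearD /= mulrDr IH IH'.
by rewrite tpureM !auglE augM -scalerAl -scalerAr scalerA.
Qed.

Fact augr_monoid : monoid_morphism augr.
Proof.
split=> [|u v]; first by rewrite -tpure1 augrE aug1 scale1r.
elim/(@tens_ind K A B): u => [a b|u u' IH IH']; last first.
  by rewrite mulrDl !linearD /= mulrDl IH IH'.
elim/(@tens_ind K A B): v => [c e|v v' IH IH']; last first.
  by rewrite mulrDr !linearD /= mulrDr IH IH'.
by rewrite tpureM !augrE augM -scalerAl -scalerAr scalerA.
Qed.

HB.instance Definition _ :=
  GRing.isMonoidMorphism.Build (ktens A B) B augl augl_monoid.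
HB.instance Definition _ :=
  GRing.isMonoidMorphism.Build (ktens A B) A augr augr_monoid.

End Slices.

(** * Contraction of the coproduct *)

Section Contraction.
Context {K : fieldType} {L : lieAlgType K}.
Local Notation H := (U L).

Lemma aug_ugen x : aug (ugen x : H) = 0.
Proof. exact: (ulift_gen (lie_rep0 L)). Qed.

Lemma augl_Delta (h : H) : augl (Delta h) = h.
Proof.
apply: (ulift_unique (f := @augl K H H \o Delta) (g := idfun)) => x /=.
by rewrite DeltaE linearD /= !auglE aug_ugen aug1 scale0r scale1r add0r.
Qed.

Lemma augr_Delta (h : H) : augr (Delta h) = h.
Proof.
apply: (ulift_unique (f := @augr K H H \o Delta) (g := idfun)) => x /=.
by rewrite DeltaE linearD /= !augrE aug_ugen aug1 scale0r scale1r addr0.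
Qed.

(** The action of the dual of [U L] on [U L]. *)
Definition contract (f : {scalar H}) (h : H) : H := slice f (Delta h).

Fact contract_linear f : linear (contract f).
Proof. by move=> c x y; rewrite /contract !linearP. Qed.

HB.instance Definition _ f :=
  GRing.isLinear.Build K H H *:%R (contract f) (contract_linear f).

Lemma contract1 f : contract f 1 = (f 1)%:A.
Proof. by rewrite /contract rmorph1 -tpure1 sliceE. Qed.

Fact fun_lmul_scalar (f : {scalar H}) (x : H) : scalar (fun h => f (x * h)).
Proof. by move=> c u v; rewrite mulrDr -scalerAr linearP. Qed.

Definition fun_lmul f x := functional (fun_lmul_scalar f x).

(** Immediate from [Δ (x h) = (x ⊗ 1 + 1 ⊗ x) Δ h]. *)
Lemma contract_gen f x h :
  contract f (ugen x * h) = contract (fun_lmul f (ugen x)) h + ugen x * contract f h.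
Proof.
rewrite /contract rmorphM /= DeltaE; move: (Delta h) => u.
elim/(@tens_ind K H H): u => [a b|u v IHu IHv].
  by rewrite mulrDl !tpureM !mul1r linearD /= !sliceE -scalerAr.
by rewrite mulrDr !linearD /= IHu IHv mulrDr addrACA.
Qed.

End Contraction.

(** * The filtration by word length *)

Section Filtration.
Context {K : fieldType} {L : lieAlgType K}.
Local Notation H := (U L).

(** Sums of products of fewer than [n] generators.  With the strict bound,
    level 0 is the zero space and level 1 the scalars, so that lower degree
    makes sense in degree 0 too. *)
Inductive ufilt : nat -> H -> Prop :=
| ufilt0 n : ufilt n 0
| ufiltD n x y : ufilt n x -> ufilt n y -> ufilt n (x + y)
| ufilt_const n c : ufilt n.+1 c%:A
| ufilt_gen n x h : ufilt n h -> ufilt n.+1 (ugen x * h).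

Lemma ufilt_0 h : ufilt 0 h -> h = 0.
Proof.
suff gen n : ufilt n h -> n = 0%N -> h = 0 by move/gen; apply.
by elim=> // {}n u v _ IHu _ IHv n0; rewrite IHu ?IHv ?addr0.
Qed.

Lemma ufilt_1 h : ufilt 1 h -> exists c, h = c%:A.
Proof.
suff gen n : ufilt n h -> n = 1%N -> exists c, h = c%:A by move/gen; apply.
elim=> {n h} [n|n u v _ IHu _ IHv|n c|n x h nh _] e.
- by exists 0; rewrite scale0r.
- have [c ->] := IHu e; have [d ->] := IHv e.
  by exists (c + d); rewrite scalerDl.
- by exists c.
- by case: e nh => -> /ufilt_0 ->; exists 0; rewrite mulr0 scale0r.
Qed.

Lemma ufiltZ n c h : ufilt n h -> ufilt n (c *: h).
Proof.
elim=> {n h} [n|n x y _ IHx _ IHy|n a|n x h _ IHh].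
- by rewrite scaler0; apply: ufilt0.
- by rewrite scalerDr; apply: ufiltD.
- by rewrite scalerA; apply: ufilt_const.
- by rewrite scalerAr; apply: ufilt_gen.
Qed.

Lemma ufiltB n x y : ufilt n x -> ufilt n y -> ufilt n (x - y).
Proof. by move=> hx hy; rewrite -scaleN1r; apply/ufiltD/ufiltZ. Qed.

Lemma ufilt_sum n I (r : seq I) (P : pred I) (F : I -> H) :
  (forall i, P i -> ufilt n (F i)) -> ufilt n (\sum_(i <- r | P i) F i).
Proof. by move=> FP; apply: big_ind => //; [apply: ufilt0 | apply: ufiltD]. Qed.

Lemma ufiltS n h : ufilt n h -> ufilt n.+1 h.
Proof.
elim=> {n h} [n|n x y _ IHx _ IHy|n a|n x h _ IHh].
- exact: ufilt0.
- exact: ufiltD.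
- exact: ufilt_const.
- exact: ufilt_gen.
Qed.

Lemma ufilt_le m n h : (m <= n)%N -> ufilt m h -> ufilt n h.
Proof. by move/subnK <-; elim: (n - m)%N => // k IHk /IHk/ufiltS. Qed.

Lemma ufilt_pred n h : ufilt n.-1 h -> ufilt n h.
Proof. exact/ufilt_le/leq_pred. Qed.

Lemma ufilt_gen_pred n x h : ufilt n.-1 h -> ufilt n (ugen x * h).
Proof.
case: n => [/ufilt_0 ->|n]; last exact: ufilt_gen.
by rewrite mulr0; apply: ufilt0.
Qed.

Lemma ufiltM m n u v : ufilt m u -> ufilt n v -> ufilt (m + n).-1 (u * v).
Proof.
move=> mu nv; elim: mu => {m u} [m|m x y _ IHx _ IHy|m c|m x h _ IHh].
- by rewrite mul0r; apply: ufilt0.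
- by rewrite mulrDl; apply: ufiltD.
- rewrite -scalerAl mul1r; apply/ufiltZ/(ufilt_le _ nv).
  by rewrite addSn leq_addl.
- by rewrite -mulrA addSn; apply: ufilt_gen_pred.
Qed.

Lemma ufilt_ex h : exists n, ufilt n h.
Proof.
elim/(@u_ind K L): h => [c|x|x y [m hx] [n hy]|x y [m hx] [n hy]].
- by exists 1%N; apply: ufilt_const.
- by exists 2%N; rewrite -[ugen x]mulr1 -[1]scale1r; apply/ufilt_gen/ufilt_const.
- exists (m + n)%N; apply: ufiltD.
  + exact: ufilt_le (leq_addr _ _) hx.
  + exact: ufilt_le (leq_addl _ _) hy.
- by exists (m + n).-1; apply: ufiltM.
Qed.

Lemma contract_const f c : contract f (c%:A : H) = f 1 *: c%:A.
Proof. by rewrite linearZ /= contract1 !scalerA mulrC. Qed.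

(** [Δ h = 1 ⊗ h] up to terms with second leg of lower degree. *)
Lemma contract_sub n h (f : {scalar H}) :
  ufilt n h -> ufilt n.-1 (contract f h - f 1 *: h).
Proof.
move=> nh; elim: nh f => {n h} [n|n x y _ IHx _ IHy|n c|n x h nh IHh] f.
- by rewrite linear0 scaler0 subr0; apply: ufilt0.
- by rewrite linearD scalerDr opprD addrACA; apply: ufiltD; [apply: IHx | apply: IHy].
- by rewrite contract_const subrr; apply: ufilt0.
- rewrite contract_gen -addrA scalerAr -mulrBr.
  apply: ufiltD; last exact: ufilt_gen_pred.
  rewrite -[contract _ h](subrK (fun_lmul f (ugen x) 1 *: h)).
  by apply: ufiltD; [exact/ufilt_pred/IHh | exact: ufiltZ].
Qed.

Lemma contract_filt n h (f : {scalar H}) : ufilt n h -> ufilt n (contract f h).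
Proof.
move=> nh; rewrite -[contract _ h](subrK (f 1 *: h)).
by apply: ufiltD; [exact/ufilt_pred/contract_sub | exact: ufiltZ].
Qed.

Lemma contract_lower n h (f : {scalar H}) :
  f 1 = 0 -> ufilt n h -> ufilt n.-1 (contract f h).
Proof. by move=> f1 /(contract_sub f); rewrite f1 scale0r subr0. Qed.

(** The defect is [contract_sub] for the functional [f (x * _)]. *)
Lemma contract_leibniz n h x (f : {scalar H}) : ufilt n h ->
  ufilt n.-1 (contract f (ugen x * h) - (f (ugen x) *: h + ugen x * contract f h)).
Proof.
move=> nh; rewrite contract_gen opprD addrACA subrr addr0.
by have := contract_sub (fun_lmul f (ugen x)) nh; rewrite /= mulr1.
Qed.

End Filtration.

(** * The symbol map *)

Section Symbol.
Context {K : fieldType} {L : lieAlgType K}.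
Hypothesis char0 : [pchar K] =i pred0.
Local Notation H := (U L).
Context (d : nat) (x : 'I_d -> L) (xi : 'I_d -> {scalar H}).
Hypothesis xi1 : forall i, xi i 1 = 0.
Hypothesis span : forall y, ugen y = \sum_i xi i (ugen y) *: (ugen (x i) : H).

Lemma charn n : n.+1%:R != 0 :> K.
Proof. by have /GRing.pcharf0P -> := char0. Qed.

(** Euler's identity holds up to lower degree: there [∂_i] is a derivation and
    [x_i] commutes with the other generators. *)
Lemma euler n h :
  ufilt n h -> ufilt n.-1 (\sum_i ugen (x i) * contract (xi i) h - n.-1%:R *: h).
Proof.
elim=> {n h} [n|n u v _ IHu _ IHv|n c|n y h nh IHh].
- rewrite scaler0 subr0; apply: ufilt_sum => i _.
  by rewrite linear0 mulr0; apply: ufilt0.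
- rewrite scalerDr opprD.
  under eq_bigr do rewrite linearD mulrDr.
  by rewrite big_split addrACA; apply: ufiltD.
- rewrite big1 => [|i _]; last by rewrite contract_const xi1 scale0r mulr0.
  rewrite sub0r -scaleNr; case: n => [|n]; last exact/ufiltZ/ufilt_const.
  by rewrite oppr0 scale0r; apply: ufilt0.
- rewrite /=; case: n => [|n] in nh IHh *.
    rewrite (ufilt_0 nh) mulr0 scaler0 subr0; apply: ufilt_sum => i _.
    by rewrite linear0 mulr0; apply: ufilt0.
  rewrite /= in IHh.
  have yhE : ugen y * h = \sum_i xi i (ugen y) *: ugen (x i) * h.
    by rewrite {1}span mulr_suml.
  (* Three defects of lower degree: of the Leibniz rule, of commuting [x i] past
     [y], and of the induction hypothesis. *)
  have -> : \sum_i ugen (x i) * contract (xi i) (ugen y * h) - n.+1%:R *: (ugen y * h)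
     = \sum_i ugen (x i) * (contract (xi i) (ugen y * h)
                - (xi i (ugen y) *: h + ugen y * contract (xi i) h))
      + \sum_i ugen (lie (x i) y) * contract (xi i) h
      + ugen y * (\sum_i ugen (x i) * contract (xi i) h - n%:R *: h).
    rewrite [in RHS]mulrBr mulr_sumr addrA -!big_split /= -addn1 natrD scalerDl.
    rewrite opprD addrA -scalerAr addrAC; congr (_ - _).
    rewrite scale1r [X in _ - X = _]yhE -sumrB; apply: eq_bigr => i _.
    rewrite ugen_lie mulrBr mulrDr mulrBl -scalerAr scalerAl !mulrA.
    by rewrite opprD !addrA !subrK.
  apply: ufiltD; last exact: ufilt_gen.
  apply: ufiltD; apply: ufilt_sum => i _.
    by apply: ufilt_gen; apply: (contract_leibniz _ _ nh).
  exact/ufilt_gen/(contract_lower (xi1 i) nh).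
Qed.

Local Notation A := {mpoly K[d]}.

Definition symb_gen y : A := \sum_i xi i (ugen y) *: 'X_i.

(** The degree [n] part of the exponential of [Σ X_i ∂_i], followed by the
    counit.  On a product of [n] generators it is the product of their images
    under [symb_gen], see [symb_genM]. *)
Fixpoint symb n (h : H) : A :=
  if n is m.+1 then m.+1%:R^-1 *: \sum_i 'X_i * symb m (contract (xi i) h)
  else (aug h)%:MP.

Lemma symbP n : linear (symb n).
Proof.
elim: n => [|n IHn] c u v /=; first by rewrite aug_scalar mpolyCD mpolyCM mul_mpolyC.
rewrite scalerA [c * _]mulrC -scalerA -scalerDr [in RHS]scaler_sumr -big_split.
congr (_ *: _).
by apply: eq_bigr => i _; rewrite linearP IHn mulrDr scalerAr.
Qed.

HB.instance Definition _ n := GRing.isLinear.Build K H A *:%R (symb n) (symbP n).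

Lemma symb_lt n h : ufilt n h -> symb n h = 0.
Proof.
elim: n h => [|n IHn] h nh; first by rewrite (ufilt_0 nh) linear0.
rewrite /= big1 ?scaler0 // => i _.
by rewrite IHn ?mulr0 //; apply: contract_lower nh.
Qed.

Lemma symb_eq n u v : ufilt n (u - v) -> symb n u = symb n v.
Proof. by move/symb_lt; rewrite linearB => /eqP; rewrite subr_eq0 => /eqP. Qed.

Lemma symbS n h : n.+1%:R *: symb n.+1 h = \sum_i 'X_i * symb n (contract (xi i) h).
Proof. by rewrite /= scalerA mulfV ?charn ?scale1r. Qed.

Lemma symb_contract_gen n y h i : ufilt n.+1 h ->
  symb n (contract (xi i) (ugen y * h)) =
    xi i (ugen y) *: symb n h + symb n (ugen y * contract (xi i) h).
Proof. by move/(contract_leibniz y (xi i))/symb_eq->; rewrite linearP. Qed.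

Lemma symb_genM n y h : ufilt n.+1 h -> symb n.+1 (ugen y * h) = symb_gen y * symb n h.
Proof.
elim: n h => [|n IHn] h nh.
  apply: (scalerI (charn 0)); rewrite [LHS]symbS.
  under eq_bigr => i _.
    rewrite (symb_contract_gen _ _ nh) (ufilt_0 (contract_lower (xi1 i) nh)).
    by rewrite mulr0 linear0 addr0 -scalerAr scalerAl over.
  by rewrite -mulr_suml scale1r.
apply: (scalerI (charn n.+1)); rewrite [LHS]symbS.
under eq_bigr => i _.
  rewrite (symb_contract_gen _ _ nh) IHn; last exact: (contract_lower (xi1 i) nh).
  by rewrite mulrDr -scalerAr scalerAl mulrCA over.
rewrite big_split -mulr_suml -mulr_sumr -symbS -[in RHS]addn1 natrD scalerDl scale1r.
by rewrite addrC scalerAr.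
Qed.

Lemma symb_const n c : symb n.+1 (c%:A) = 0.
Proof.
rewrite /= big1 ?scaler0 // => i _.
by rewrite contract_const xi1 scale0r linear0 mulr0.
Qed.

Lemma symbM m n u v : ufilt m.+1 u -> ufilt n.+1 v ->
  symb (m + n) (u * v) = symb m u * symb n v.
Proof.
move=> mu nv; move: mu; move Ek: m.+1 => k mu.
elim: mu m Ek => {k u} [k|k u u' _ IHu _ IHu'|k c|k y h kh IHh] m.
- by rewrite mul0r !linear0 mul0r.
- by move=> Ek; rewrite mulrDl !linearD /= mulrDl IHu ?IHu'.
- rewrite -scalerAl mul1r linearZ /= => _; case: m => [|m].
    by rewrite /= aug_const mul_mpolyC.
  rewrite symb_const mul0r symb_lt ?scaler0 //.
  by apply: ufilt_le nv; rewrite addSn ltnS leq_addl.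
case=> Ek; case: m Ek => [|m] Ek.
  by rewrite -Ek in kh; rewrite (ufilt_0 kh) mulr0 mul0r !linear0 mul0r.
rewrite -Ek in kh; rewrite -mulrA addSn !symb_genM //; last first.
  by have := ufiltM kh nv; rewrite addnS addSn.
by rewrite (IHh _ Ek) mulrA.
Qed.

(** By induction on [h], both sides obeying the same Leibniz rule. *)
Lemma symb_deriv n h i : ufilt n.+2 h ->
  (symb n.+1 h)^`M(i) = symb n (contract (xi i) h).
Proof.
move Ek: n.+2 => k kh.
elim: kh n Ek => {k h} [k|k u v _ IHu _ IHv|k c|k y h kh IHh] n.
- by rewrite !linear0.
- by move=> Ek; rewrite !linearD; congr (_ + _); [apply: IHu | apply: IHv].
- by rewrite symb_const contract_const xi1 scale0r !linear0.
case=> Ek; rewrite -Ek in kh; rewrite symb_genM // mderivM symb_contract_gen //.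
congr (_ + _).
  rewrite /symb_gen linear_sum /= (bigD1 i) //= big1 ?addr0 => [|j ji].
    have UU0 : (U_(i) - U_(i) = 0 :> 'X_{1..d})%MM.
      by apply/mnmP=> j; rewrite mnmBE mnm0E subnn.
    by rewrite linearZ /= mderivX mnm1E eqxx scale1r UU0 mpolyX0 -scalerAl mul1r.
  by rewrite linearZ /= mderivX mnm1E (negPf ji) scale0r scaler0.
case: n => [|n] in Ek kh *.
  by rewrite (ufilt_0 (contract_lower (xi1 i) kh)) mulr0 linear0 /= mderivC mulr0.
rewrite symb_genM; first by rewrite (IHh _ Ek).
exact: (contract_lower (xi1 i) kh).
Qed.

(** If the symbol of [h] is 0 then so are its partial derivatives, which are the
    symbols of the [∂_i h]; by induction the [∂_i h] drop in degree by two, and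
    Euler's identity recovers [h] from them. *)
Lemma symb_inj n h : ufilt n.+1 h -> symb n h = 0 -> ufilt n h.
Proof.
elim: n h => [|n IHn] h nh h0.
  have [c hc] := ufilt_1 nh; move: h0; rewrite hc /= aug_const => /eqP.
  by rewrite mpolyC_eq0 => /eqP ->; rewrite scale0r; apply: ufilt0.
rewrite -[h]scale1r -(mulVf (charn n)) -scalerA; apply: ufiltZ.
rewrite -[_ *: h](subKr (\sum_i ugen (x i) * contract (xi i) h)).
apply: ufiltB (euler nh); apply: ufilt_sum => i _; apply: ufilt_gen.
apply: IHn; first exact: (contract_lower (xi1 i) nh).
by rewrite -symb_deriv // h0 linear0.
Qed.

Lemma ufilt_dvd m n (u v : H) : ufilt m.+1 u -> ufilt n.+1 v ->
  ufilt (m + n) (u * v) -> ufilt m u \/ ufilt n v.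
Proof.
move=> mu nv /symb_lt/eqP; rewrite symbM // mulf_eq0.
by case/orP=> /eqP; [left | right]; apply: symb_inj.
Qed.

End Symbol.

(** * Degrees add in the enveloping algebra *)

Section Domain.
Context {K : fieldType} {L : lieAlgType K}.
Hypothesis char0 : [pchar K] =i pred0.
Local Notation H := (U L).

(** The functionals of a dual system for the image of [L] are made to vanish at 1
    by subtracting multiples of the counit, which is 0 on that image. *)
Lemma ugen_coordinates : exists d (x : 'I_d -> L) (xi : 'I_d -> {scalar H}),
  (forall i, xi i 1 = 0) /\
  (forall y, ugen y = \sum_i xi i (ugen y) *: (ugen (x i) : H)).
Proof.
pose gl := GRing.isLinear.Build K L H *:%R (@ugen K L) (@ugen_linear K L).
pose g : {linear L -> H} := HB.pack (@ugen K L) gl.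
pose b := vbasis (@fullv K L).
have [||d [v [eta [_ Sv span]]]] :=
    @dual_system K H [seq ugen y | y <- b] (fun h => exists y, h = ugen y).
- by move=> c _ _ [y ->] [z ->]; exists (c *: y + z); rewrite ugen_linear.
- by move=> _ /mapP[y _ ->]; exists y.
have {Sv} [x xE] := choice Sv.
have xil i : scalar (fun h : H => eta i h - eta i 1 * aug h).
  move=> c h h'; rewrite linearP aug_scalar mulrDr mulrCA opprD addrACA.
  by rewrite -mulrBr.
exists d, x, (fun i => functional (xil i)); split=> [i|y] /=.
  by rewrite aug1 mulr1 subrr.
under eq_bigr => i _ do rewrite aug_ugen mulr0 subr0 -xE.
have -> : ugen y = \sum_(j < \dim (@fullv K L)) coord b j y *: g b`_j.
  rewrite -[ugen y]/(g y) {1}(coord_vbasis (memvf y)) linear_sum.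
  by apply: eq_bigr => j _; rewrite linearZ.
under [RHS]eq_bigr => i _ do rewrite linear_sum scaler_suml.
rewrite exchange_big; apply: eq_bigr => j _ /=.
rewrite {1}(span (ugen b`_j)); last by apply/map_f/mem_nth; rewrite size_tuple.
by rewrite scaler_sumr; apply: eq_bigr => i _; rewrite scalerA linearZ.
Qed.

Lemma ufiltM_lt m n (u v : H) : ufilt m.+1 u -> ufilt n.+1 v ->
  ufilt (m + n) (u * v) -> ufilt m u \/ ufilt n v.
Proof.
have [d [x [xi [xi1 span]]]] := ugen_coordinates.
exact: (ufilt_dvd char0 xi1 span).
Qed.

Lemma ufilt_exact (u : H) : u != 0 -> exists2 n, ufilt n.+1 u & ~ ufilt n u.
Proof.
have [n] := ufilt_ex u; elim: n => [/ufilt_0-> /eqP //|n IHn nu u0].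
by have [/IHn|] := pselect (ufilt n u); [apply | exists n].
Qed.

Lemma U_mulf_eq0 (u v : H) : u * v = 0 -> u = 0 \/ v = 0.
Proof.
move=> uv0; have [->|/ufilt_exact[m mu mu']] := eqVneq u 0; first by left.
have [->|/ufilt_exact[n nv nv']] := eqVneq v 0; first by right.
by have [] := ufiltM_lt mu nv; rewrite // uv0; apply: ufilt0.
Qed.

End Domain.

(** * Solutions of the cocycle equations *)

Section Cocycle.
Context {K : fieldType} {L : lieAlgType K}.
Hypothesis char0 : [pchar K] =i pred0.
Local Notation H := (U L).

Lemma aug_augr (b : ktens H H) : aug (augr b) = aug (augl b).
Proof.
elim/(@tens_ind K H H): b => [u v|x y IHx IHy].
  by rewrite augrE auglE !augZ mulrC.
by rewrite !linearD /= !augD IHx IHy.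
Qed.

Lemma aug_slice (f : {scalar H}) (b : ktens H H) : aug (slice f b) = f (augr b).
Proof.
elim/(@tens_ind K H H): b => [u v|x y IHx IHy].
  by rewrite augrE sliceE augZ linearZ /= mulrC.
by rewrite !linearD /= augD IHx IHy.
Qed.

Lemma slice_mul1 (f : {scalar H}) h (b : ktens H H) :
  slice f ((1 ⊗ h) * b) = h * slice f b.
Proof.
elim/(@tens_ind K H H): b => [u v|x y IHx IHy].
  by rewrite tpureM !sliceE mul1r -scalerAr.
by rewrite mulrDr !linearD /= IHx IHy mulrDr.
Qed.

(** [id ⊗ ε ⊗ id] *)
Definition augm : ktens (ktens H H) H -> ktens H H := tmap (@augr K H H) idfun.

HB.instance Definition _ := GRing.isLinear.Build K _ _ *:%R augm
  (tmap_linear (@augr K H H) idfun).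
HB.instance Definition _ := GRing.isMonoidMorphism.Build _ _ augm
  (tmap_monoid_morphism (@augr K H H) idfun).

Lemma augmE (b : ktens H H) h : augm (b ⊗ h) = augr b ⊗ h.
Proof. exact: (tmapE (@augr K H H) idfun). Qed.

Lemma augm_tassoc (h : H) (b : ktens H H) : augm (tassoc (h ⊗ b)) = h ⊗ augl b.
Proof.
elim/(@tens_ind K H H): b => [u v|x y IHx IHy].
  by rewrite tassocE augmE augrE auglE tpureC.
by rewrite !(tpureDr, linearD) /= IHx IHy.
Qed.

Lemma augr_tassoc (h : H) (b : ktens H H) : augr (tassoc (h ⊗ b)) = h ⊗ augr b.
Proof.
elim/(@tens_ind K H H): b => [u v|x y IHx IHy].
  by rewrite tassocE !augrE tpureZr.
by rewrite !(tpureDr, linearD) /= IHx IHy.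
Qed.

Lemma augm_Delta_id (b : ktens H H) : augm (Delta_id b) = b.
Proof.
elim/(@tens_ind K H H): b => [u v|x y IHx IHy].
  by rewrite Delta_idE augmE augr_Delta.
by rewrite !linearD /= IHx IHy.
Qed.

Lemma augr_Delta_id (b : ktens H H) : augr (Delta_id b) = Delta (augr b).
Proof.
elim/(@tens_ind K H H): b => [u v|x y IHx IHy].
  by rewrite Delta_idE !augrE linearZ.
by rewrite !linearD /= IHx IHy.
Qed.

Lemma augm_id_Delta (b : ktens H H) : augm (id_Delta b) = b.
Proof.
elim/(@tens_ind K H H): b => [u v|x y IHx IHy].
  by rewrite id_DeltaE augm_tassoc augl_Delta.
by rewrite !linearD /= IHx IHy.
Qed.

Lemma augr_id_Delta (b : ktens H H) : augr (id_Delta b) = b.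
Proof.
elim/(@tens_ind K H H): b => [u v|x y IHx IHy].
  by rewrite id_DeltaE augr_tassoc augr_Delta.
by rewrite !linearD /= IHx IHy.
Qed.

(** If [g <> 1], a functional [f] with [f g - f 1 = 1] contracts [Δ g - 1 ⊗ g] to
    [g] itself, while the contraction has lower degree than [g]. *)
Lemma grouplike1 (g : H) : Delta g = g ⊗ g -> g = 0 \/ g = 1.
Proof.
move=> Dg; have [->|g0] := eqVneq g 0; [by left | right].
have [n ng nng] := ufilt_exact g0.
apply/eqP; rewrite -subr_eq0; apply/negPn/negP=> /scalar_separates[f fg].
apply: nng; have := contract_sub f ng.
by rewrite /contract Dg sliceE -scalerBl -linearB fg scale1r.
Qed.

(** Counits in the middle and in the last leg give [bg] and [fb]; a degree count
    on [fb] then makes all slices of [b] scalar. *)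
Lemma cocycle01 (b : ktens H H) :
  Delta_id b = tassoc ((1 : H) ⊗ b) * id_Delta b -> b = 0 \/ b = 1.
Proof.
move=> bE.
have bg : b = (1 ⊗ augl b) * b.
  by rewrite -{1}(augm_Delta_id b) bE rmorphM /= augm_tassoc augm_id_Delta.
have fb : Delta (augr b) = (1 ⊗ augr b) * b.
  by rewrite -augr_Delta_id bE rmorphM /= augr_tassoc augr_id_Delta.
have [g0|g1] : augl b = 0 \/ augl b - 1 = 0.
- apply: (U_mulf_eq0 char0); rewrite mulrBr mulr1.
  by rewrite {3}bg rmorphM /= auglE aug1 scale1r subrr.
- by left; rewrite bg g0 tpure0r mul0r.
right; set f := augr b in fb.
have aug_f : aug f = 1 by rewrite aug_augr -(subrK 1 (augl b)) g1 add0r aug1.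
have f0 : f != 0.
  apply/eqP=> f0; have := aug_f; rewrite f0 -(scale0r 1) aug_const => /eqP.
  by rewrite eq_sym oner_eq0.
have [n nf nnf] := ufilt_exact f0.
have slb eta : slice eta b = (eta f)%:A.
  suff [c sc] : exists c, slice eta b = c%:A.
    by rewrite sc -aug_slice sc aug_const.
  have [->|/ufilt_exact[[|m] mw nmw]] := eqVneq (slice eta b) 0.
  - by exists 0; rewrite scale0r.
  - exact: ufilt_1.
  have [] := ufiltM_lt char0 nf mw; rewrite // -slice_mul1 -fb.
  by apply: ufilt_le (contract_filt eta nf); rewrite addnS ltnS leq_addr.
have bf : b = f ⊗ 1.
  apply/eqP; rewrite -subr_eq0; apply/eqP/slice_ext0 => eta.
  by rewrite linearB /= slb sliceE subrr.
have [] : f = 0 \/ f = 1; last by rewrite bf => ->.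
  by apply: grouplike1; rewrite fb bf tpureM mul1r mulr1.
by move/eqP; rewrite (negPf f0).
Qed.

(** The first equation makes the first leg of [a] trivial; the second one then
    says that the other leg is group-like. *)
Lemma cocycle_left (a : ktens H H) :
  Delta_id a = tassoc ((1 : H) ⊗ a) -> (a ⊗ (1 : H)) * Delta_id a = id_Delta a ->
  a = 0 \/ a = 1.
Proof.
move=> aE aa.
have ag : a = 1 ⊗ augl a by rewrite -augm_tassoc -aE augm_Delta_id.
have aug23 b : tmap (@augl K H H) (@idfun H) (tassoc (1 ⊗ b)) = b.
  elim/(@tens_ind K H H): b => [u v|x y IHx IHy].
    by rewrite tassocE tmapE /= auglE aug1 scale1r.
  by rewrite tpureDr !linearD /= IHx IHy.
have [] := @grouplike1 (augl a).
- rewrite -[LHS]aug23 -id_DeltaE -ag -aa {1 2}ag Delta_idE rmorph1 tpureM.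
  by rewrite mul1r mulr1 -[RHS]aug23 tassocE.
- by move=> g0; left; rewrite ag g0 tpure0r.
- by move=> g1; right; rewrite ag g1.
Qed.

End Cocycle.

(** * Coordinates on a free module of rank two *)

Section Coordinates.
Context {H T : pzRingType} (D : {rmorphism H -> T}) (P : lmodType H).

Definition hcoord (p : P -> H) : htens D P -> T := hlift (fun a x => a * D (p x)).

Context (p : P -> H) (pl : scalar p).

Lemma hcoord_bal : balanced (hract D) (@hlact H P) (fun a x => a * D (p x)).
Proof.
have pD x y : p (x + y) = p x + p y by rewrite -{1}[x]scale1r pl mul1r.
split=> [a a' x|a x y|a h x]; first by rewrite mulrDl.
  by rewrite pD rmorphD mulrDr.
rewrite /hract /hlact -[h *: x]addr0 pl rmorphD rmorphM mulrDr mulrA.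
suff -> : p 0 = 0 by rewrite rmorph0 mulr0 addr0.
by apply: (addrI (p 0)); rewrite -pD !addr0.
Qed.

Lemma hcoordE a x : hcoord p (a ⊗_H x) = a * D (p x).
Proof. exact: (bt_liftE hcoord_bal). Qed.

Lemma hcoordD : {morph hcoord p : u v / u + v}.
Proof. exact: (bt_liftD hcoord_bal). Qed.

End Coordinates.

Section HPure.
Context {H T : pzRingType} (D : H -> T) (P : lmodType H).

Lemma hpure0l (x : P) : (0 ⊗_H x : htens D P) = 0.
Proof. by apply: (addrI (0 ⊗_H x)); rewrite -hpureDl !addr0. Qed.
End HPure.

Definition dual_basis2 (H : pzRingType) (P : lmodType H) (e1 e2 : P)
    (p1 p2 : P -> H) : Prop :=
  [/\ scalar p1, scalar p2, (p1 e1, p1 e2, p2 e1, p2 e2) = (1, 0, 0, 1) &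
      forall x, x = p1 x *: e1 + p2 x *: e2].

Lemma basis2_dual (H : pzRingType) (P : lmodType H) (e1 e2 : P) :
  is_basis2 e1 e2 -> exists p1 p2, dual_basis2 e1 e2 p1 p2.
Proof.
case=> q fK qK; exists (fun x => (q x).1), (fun x => (q x).2).
have inj h1 h2 x : x = h1 *: e1 + h2 *: e2 -> q x = (h1, h2).
  by move=> ->; apply: (fK (h1, h2)).
have ql c x y : q (c *: x + y) = (c * (q x).1 + (q y).1, c * (q x).2 + (q y).2).
  apply: inj; rewrite -{1}[x]qK -{1}[y]qK.
  by rewrite !scalerDl scalerDr !scalerA addrACA.
have q1 : q e1 = (1, 0) by apply: inj; rewrite scale0r scale1r addr0.
have q2 : q e2 = (0, 1) by apply: inj; rewrite scale0r scale1r add0r.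
by split=> [c x y|c x y||x]; rewrite ?ql ?q1 ?q2 // {1}[x]qK.
Qed.

Lemma is_basis2C (H : pzRingType) (P : lmodType H) (e1 e2 : P) :
  is_basis2 e1 e2 -> is_basis2 e2 e1.
Proof.
case=> q fK qK; exists (fun x => ((q x).2, (q x).1)) => [[h1 h2]|x] /=.
  by rewrite addrC (fK (h2, h1)).
by rewrite addrC qK.
Qed.

(** * Associativity on basis elements *)

Section Multiplication.
Context {K : fieldType} {L : lieAlgType K} {P : lmodType (U L)}.
Local Notation H := (U L).
Context (ast : P -> P -> H2tens P) (past : is_pseudoalgebra ast).

Local Notation astl := (astl ast).
Local Notation astr := (astr ast).

Lemma astlZ (b : ktens H H) h u z :
  astl (b *: u) (h *: z) = (b ⊗ h) *: astl u z.
Proof.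
elim/(@htens_ind H (ktens H H) Delta P): u => [a x|u v IHu IHv].
  rewrite hpureZ !(astlE past) -{1}[x]scale1r (pa_bilinear past) expandlZ Delta_idE.
  by rewrite rmorph1 !scalerA !tpureM !mul1r !mulr1.
by rewrite scalerDr !(astlD past) IHu IHv scalerDr.
Qed.

Lemma astrZ (b : ktens H H) h x u :
  astr (h *: x) (b *: u) = tassoc (h ⊗ b) *: astr x u.
Proof.
elim/(@htens_ind H (ktens H H) Delta P): u => [a y|u v IHu IHv].
  rewrite hpureZ !(astrE past) -{1}[y]scale1r (pa_bilinear past) expandrZ id_DeltaE.
  by rewrite rmorph1 !scalerA -!rmorphM !tpureM !mul1r !mulr1.
by rewrite scalerDr !(astrD past) IHu IHv scalerDr.
Qed.

Lemma astlDr u z z' : astl u (z + z') = astl u z + astl u z'.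
Proof.
elim/(@htens_ind H (ktens H H) Delta P): u => [a x|u v IHu IHv].
  by rewrite 3!(astlE past) (pa_Dr past) (expandlD (ast x z)) scalerDr.
by rewrite !(astlD past) IHu IHv addrACA.
Qed.

Lemma astrDl x x' u : astr (x + x') u = astr x u + astr x' u.
Proof.
elim/(@htens_ind H (ktens H H) Delta P): u => [a y|u v IHu IHv].
  by rewrite 3!(astrE past) (pa_Dl past) (expandrD (ast x y)) scalerDr.
by rewrite !(astrD past) IHu IHv addrACA.
Qed.

(** Generation of [P] by [S] is stated as an induction principle, which is how
    it is used, once for each of the three arguments. *)
Lemma pseudo_associative_gen (S : P -> Prop) :
  (forall Q : P -> Prop, (forall x y, Q x -> Q y -> Q (x + y)) ->
     (forall h x, Q x -> Q (h *: x)) -> (forall x, S x -> Q x) -> forall x, Q x) ->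
  (forall x y z, S x -> S y -> S z -> astl (ast x y) z = astr x (ast y z)) ->
  pseudo_associative ast.
Proof.
move=> gen assoc x y z.
(* Scaling one argument at a time suffices; the other two scalars are then 1. *)
have Z (h g f : H) u v w : astl (ast u v) w = astr u (ast v w) ->
    astl (ast (h *: u) (g *: v)) (f *: w) = astr (h *: u) (ast (g *: v) (f *: w)).
  by move=> e; rewrite !(pa_bilinear past) astlZ astrZ tassocE e.
elim/gen: x => [x x' IHx IHx'|h x IHx|x Sx].
- by rewrite (pa_Dl past) (astlD past) astrDl IHx IHx'.
- by rewrite -[y]scale1r -[z]scale1r; apply: Z.
elim/gen: y => [y y' IHy IHy'|h y IHy|y Sy].
- by rewrite (pa_Dl past) (pa_Dr past) (astlD past) (astrD past) IHy IHy'.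
- by rewrite -[x]scale1r -[z]scale1r; apply: Z.
elim/gen: z => [z z' IHz IHz'|h z IHz|z Sz].
- by rewrite (pa_Dr past) astlDr (astrD past) IHz IHz'.
- by rewrite -[x]scale1r -[y]scale1r; apply: Z.
exact: assoc.
Qed.

Lemma astl_scalar c d x y z : ast y z = d%:A ⊗_H x ->
  astl (c%:A ⊗_H y) z = (c * d)%:A ⊗_H x.
Proof.
move=> yz; rewrite (astlE past) yz expandlE hpureZ linearZ rmorph1 tpureZl tpure1.
by rewrite -scalerAl mul1r scalerA.
Qed.

Lemma astr_scalar c d x y z : ast z y = d%:A ⊗_H x ->
  astr z (c%:A ⊗_H y) = (c * d)%:A ⊗_H x.
Proof.
move=> yz; rewrite (astrE past) yz expandrE hpureZ linearZ rmorph1 tpureZr tpure1.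
by rewrite linearZ rmorph1 -scalerAl mul1r scalerA.
Qed.

(** Here [e i ∗ e j] is the multiple [s i j] of the basis element [e (m i j)], so
    associativity is that of an ordinary algebra; the products that are 0 have
    [s i j = 0] and a value of [m i j] chosen so as to keep [m] associative. *)
Lemma table_associative (e : bool -> P) (m : bool -> bool -> bool)
    (s : bool -> bool -> K) :
  (forall x, exists h1 h2, x = h1 *: e true + h2 *: e false) ->
  (forall i j, ast (e i) (e j) = (s i j)%:A ⊗_H e (m i j)) ->
  associative m ->
  (forall i j k, s i j * s (m i j) k = s j k * s i (m j k)) ->
  pseudo_associative ast.
Proof.
move=> span astE mA sA.
apply: (@pseudo_associative_gen (fun x => exists i, x = e i)).
  move=> Q QD QZ Qe x; have [h1 [h2 ->]] := span x.
  by apply: QD; apply/QZ/Qe; [exists true | exists false].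
move=> _ _ _ [i ->] [j ->] [k ->].
by rewrite !astE (astl_scalar _ (astE _ _)) (astr_scalar _ (astE _ _)) mA sA.
Qed.

Section Mixed.
Hypothesis char0 : [pchar K] =i pred0.
Context (e1 e2 : P) (p1 p2 : P -> H) (dual : dual_basis2 e1 e2 p1 p2).
Context (t1 t2 : K) (t1_neq0 : t1 != 0) (t2_neq0 : t2 != 0).
Hypothesis ast11 : ast e1 e1 = t1%:A ⊗_H e1.
Hypothesis ast22 : ast e2 e2 = t2%:A ⊗_H e2.

Lemma hpure_dual (D : {rmorphism H -> ktens H H}) (u : htens D P) :
  u = hcoord p1 u ⊗_H e1 + hcoord p2 u ⊗_H e2.
Proof.
have [p1l p2l _ span] := dual.
elim/(@htens_ind H (ktens H H) D P): u => [a x|u v IHu IHv].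
  by rewrite !hcoordE // !hpureM -hpureDr -span.
by rewrite !hcoordD // !hpureDl addrACA -IHu -IHv.
Qed.

Lemma hpure_inj (T : pzRingType) (D : {rmorphism H -> T}) a b a' b' :
  a ⊗_H e1 + b ⊗_H e2 = a' ⊗_H e1 + b' ⊗_H e2 :> htens D P -> a = a' /\ b = b'.
Proof.
have [p1l p2l [p11 p12 p21 p22] _] := dual => eab; split.
  have := congr1 (hcoord p1) eab; rewrite !hcoordD // !hcoordE // p11 p12.
  by rewrite rmorph1 rmorph0 !mulr1 !mulr0 !addr0.
have := congr1 (hcoord p2) eab; rewrite !hcoordD // !hcoordE // p21 p22.
by rewrite rmorph1 rmorph0 !mulr1 !mulr0 !add0r.
Qed.

(** In terms of the coordinates [a] and [b], the two triples give four equations;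
    dividing [b] by [t1] and [a] by [t2] turns them into the normalised ones. *)
Lemma mixed_product :
  astl (ast e1 e1) e2 = astr e1 (ast e1 e2) ->
  astl (ast e1 e2) e2 = astr e1 (ast e2 e2) ->
  [\/ ast e1 e2 = 0, ast e1 e2 = t2%:A ⊗_H e1 | ast e1 e2 = t1%:A ⊗_H e2].
Proof.
have [a [b e12]] : exists a b, ast e1 e2 = a ⊗_H e1 + b ⊗_H e2.
  by do 2 eexists; apply: (hpure_dual (ast e1 e2)).
have expandl12 : expandl (ast e1 e2) = Delta_id a ⊗_H e1 + Delta_id b ⊗_H e2.
  by rewrite e12 (expandlD (a ⊗_H e1)) !expandlE.
have expandr12 : expandr (ast e1 e2) = id_Delta a ⊗_H e1 + id_Delta b ⊗_H e2.
  by rewrite e12 (expandrD (a ⊗_H e1)) !expandrE.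
have DeltaC (t : K) : (Delta_id (t%:A : ktens H H) = t%:A) *
    (id_Delta (t%:A : ktens H H) = t%:A).
  by split; rewrite [LHS]linearZ rmorph1.
have expandC t (x : P) :
    (expandl (t%:A ⊗_H x) = t%:A ⊗_H x) * (expandr (t%:A ⊗_H x) = t%:A ⊗_H x).
  by rewrite expandlE expandrE !DeltaC.
have tC (t : K) : (t%:A : ktens H H) ⊗ (1 : H) = t%:A by rewrite tpureZl.
have tC' (t : K) : tassoc ((1 : H) ⊗ (t%:A : ktens H H)) = t%:A.
  by rewrite tpureZr linearZ rmorph1.
have mulC (t : K) (u : ktens (ktens H H) H) : t%:A * u = t *: u.
  by rewrite -scalerAl mul1r.
have mulC' (t : K) (u : ktens (ktens H H) H) : u * t%:A = t *: u.
  by rewrite -scalerAr mulr1.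
rewrite ast11 ast22 => a112 a122.
have [a112_1 a112_2] :
    t1 *: Delta_id a = t1 *: tassoc (1 ⊗ a) + tassoc (1 ⊗ b) * id_Delta a
    /\ t1 *: Delta_id b = tassoc (1 ⊗ b) * id_Delta b.
  apply: (@hpure_inj _ Delta3); move: a112; rewrite {1}e12.
  rewrite (astlE past) (astrD past) 2!(astrE past) ast11.
  rewrite expandl12 expandr12 expandC tC !scalerDr !hpureZ !mulC mulC'.
  by rewrite addrA -hpureDl.
have [a122_1 a122_2] : (a ⊗ 1) * Delta_id a = t2 *: id_Delta a
    /\ (a ⊗ 1) * Delta_id b + t2 *: (b ⊗ 1) = t2 *: id_Delta b.
  apply: (@hpure_inj _ Delta3); move: a122; rewrite {1}e12.
  rewrite (astlD past) 2!(astlE past) (astrE past) ast22.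
  rewrite expandl12 expandr12 expandC tC' !scalerDr !hpureZ !mulC mulC'.
  by rewrite -addrA -hpureDl.
have scaled (t : K) (c : ktens H H) : t != 0 -> t^-1 *: c = 0 \/ t^-1 *: c = 1 ->
    c = 0 \/ c = t%:A.
  move=> t0 h; rewrite -[c]scale1r -(mulfV t0) -scalerA.
  by case: h => ->; [left; rewrite scaler0 | right].
have [b0|b1] : b = 0 \/ b = t1%:A.
- apply: (scaled _ _ t1_neq0); apply: (cocycle01 char0).
  rewrite tpureZr [tassoc _]linearZ [id_Delta _]linearZ -scalerAl -scalerAr -a112_2.
  by rewrite !scalerA -mulrA mulVf // mulr1 [LHS]linearZ.
- have [a0|a1] : a = 0 \/ a = t2%:A.
  + apply: (scaled _ _ t2_neq0); apply: cocycle_left.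
      rewrite tpureZr [LHS]linearZ [RHS]linearZ; congr (_ *: _).
      move: a112_1; rewrite b0 tpure0r [tassoc 0]linear0 mul0r addr0.
      exact: (scalerI t1_neq0).
    rewrite tpureZl [Delta_id _]linearZ -scalerAl -scalerAr a122_1.
    by rewrite !scalerA -mulrA mulVf // mulr1 [RHS]linearZ.
  + by constructor 1; rewrite e12 a0 b0 !hpure0l addr0.
  + by constructor 2; rewrite e12 a1 b0 hpure0l addr0.
- constructor 3; suff a0 : a = 0 by rewrite e12 a0 b1 hpure0l add0r.
  have : a ⊗ (1 : H) = 0.
    apply: (scalerI t1_neq0); rewrite scaler0.
    apply: (addIr (t2 *: (t1%:A : ktens (ktens H H) H))); rewrite add0r.
    by move: a122_2; rewrite b1 tC !DeltaC mulC'.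
  by move/(congr1 (@augr K _ _)); rewrite augrE aug1 scale1r => ->; rewrite linear0.
Qed.
(** [(e1 ∗ e2) ∗ e1] is the multiple [c * t1] of [e1], and [e1 ∗ (e2 ∗ e1)] the
    multiple [d * t1].  For [c = 0] or [d = 0] this rules out that one of [e1 ∗ e2],
    [e2 ∗ e1] is 0 and the other a nonzero multiple of [e1]. *)
Lemma mixed_scalars c d :
  astl (ast e1 e2) e1 = astr e1 (ast e2 e1) ->
  ast e1 e2 = c%:A ⊗_H e1 -> ast e2 e1 = d%:A ⊗_H e1 -> c = d.
Proof.
move=> assoc e12 e21; move: assoc; rewrite e12 e21.
rewrite (astl_scalar _ ast11) (astr_scalar _ ast11) => ecd.
have [] := @hpure_inj _ Delta3 (c * t1)%:A 0 (d * t1)%:A 0; first by rewrite ecd.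
by move/(congr1 aug); rewrite !aug_const => /(mulIf t1_neq0).
Qed.

End Mixed.
End Multiplication.

(** * Classification *)

Theorem theorem4p4 (k : closedFieldType) (char_k : [pchar k] =i pred0)
  (delta : lieAlgType k) (P : lmodType (U delta)) (e1 e2 : P)
  (basis_P : is_basis2 e1 e2)
  (ast : P -> P -> H2tens P) (past : is_pseudoalgebra ast)
  (t1 t2 : k) (t1_neq0 : t1 <> 0) (t2_neq0 : t2 <> 0)
  (ast11 : ast e1 e1 = (t1%:A ⊗ 1) ⊗_H e1)
  (ast22 : ast e2 e2 = (t2%:A ⊗ 1) ⊗_H e2) :
  pseudo_associative ast <->
     (ast e1 e2 = 0 /\ ast e2 e1 = 0)
  \/ (ast e1 e2 = (t2%:A ⊗ 1) ⊗_H e1 /\ ast e2 e1 = (t2%:A ⊗ 1) ⊗_H e1)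
  \/ (ast e1 e2 = (t1%:A ⊗ 1) ⊗_H e2 /\ ast e2 e1 = (t2%:A ⊗ 1) ⊗_H e1)
  \/ (ast e1 e2 = (t2%:A ⊗ 1) ⊗_H e1 /\ ast e2 e1 = (t1%:A ⊗ 1) ⊗_H e2)
  \/ (ast e1 e2 = (t1%:A ⊗ 1) ⊗_H e2 /\ ast e2 e1 = (t1%:A ⊗ 1) ⊗_H e2).
Proof.
have tE (t : k) : (t%:A : U delta) ⊗ (1 : U delta) = t%:A by rewrite tpureZl.
rewrite !tE in ast11 ast22 *.
move/eqP in t1_neq0; move/eqP in t2_neq0.
have [p1 [p2 dual12]] := basis2_dual basis_P.
have [q1 [q2 dual21]] := basis2_dual (is_basis2C basis_P).
have span x : exists h1 h2, x = h1 *: e1 + h2 *: e2.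
  by exists (p1 x), (p2 x); case: dual12.
split=> [assoc|].
  have zero (x : P) : 0 = (0 : k)%:A ⊗_H x :> H2tens P by rewrite scale0r hpure0l.
  have c12 c d :=
    mixed_scalars past dual12 t1_neq0 ast11 (assoc _ _ _) (c := c) (d := d).
  have c21 c d :=
    mixed_scalars past dual21 t2_neq0 ast22 (assoc _ _ _) (c := c) (d := d).
  have [e12|e12|e12] := mixed_product past char_k dual12 t1_neq0 t2_neq0 ast11 ast22
    (assoc _ _ _) (assoc _ _ _);
  have [e21|e21|e21] := mixed_product past char_k dual21 t2_neq0 t1_neq0 ast22 ast11
    (assoc _ _ _) (assoc _ _ _); try tauto.
  - by have := c21 _ _ e21 (etrans e12 (zero _)) => /eqP; rewrite (negPf t1_neq0).
  - by have := c12 _ _ (etrans e12 (zero _)) e21 => /esym/eqP; rewrite (negPf t2_neq0).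
  - by have := c12 _ _ e12 (etrans e21 (zero _)) => /eqP; rewrite (negPf t2_neq0).
  - by have := c21 _ _ (etrans e21 (zero _)) e12 => /esym/eqP; rewrite (negPf t1_neq0).
pose e i := if i then e1 else e2.
have table m s : 
  (forall i j, ast (e i) (e j) = (s i j)%:A ⊗_H e (m i j)) ->
  associative m ->
  (forall i j l, s i j * s (m i j) l = s j l * s i (m j l)) ->
  pseudo_associative ast by apply: table_associative.
case=> [|[|[|[]]]] [e12 e21].
- apply: (table andb (fun i j => if i == j then if i then t1 else t2 else 0)).
  + by case; case; rewrite /e /= ?ast11 ?ast22 ?e12 ?e21 // scale0r hpure0l.
  + exact: andbA.
  + by case; case; case; rewrite /= ?mul0r ?mulr0 // mulrC.
- apply: (table orb (fun i j => if i && j then t1 else t2)).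
  + by case; case.
  + exact: orbA.
  + by case; case; case; rewrite //= mulrC.
- apply: (table (fun _ j => j) (fun i _ => if i then t1 else t2)).
  + by case; case.
  + by [].
  + by case; case; case; rewrite //= mulrC.
- apply: (table (fun i _ => i) (fun _ j => if j then t1 else t2)).
  + by case; case.
  + by [].
  + by case; case; case; rewrite //= mulrC.
- apply: (table andb (fun i j => if i || j then t1 else t2)).
  + by case; case.
  + exact: andbA.
  + by case; case; case; rewrite //= mulrC.
Qed.
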